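(* Let $G$ be a graph with $kr$ edges, where $r$ is the rank of the cycle matroid $M(G)$, and suppose $k\ge 3$. Then the $k$-base graph $\mathfrak{G}_k(M(G))$ is connected.
   Context: The cycle matroid $M(G)$ of a graph $G$ has ground set $E(G)$ and its bases are the spanning forests of $G$ (maximal acyclic edge subsets); its rank is $|V(G)|$ minus the number of connected components of $G$. For a matroid $M$ of rank $r$ on a ground set of size $rk$, the $k$-base graph $\mathfrak{G}_k(M)$ is the graph whose vertices are the sets $\{B_1,\dots,B_k\}$ of $k$ pairwise disjoint bases of $M$, with an edge between $\{B_1,\dots,B_k\}$ and $\{D_1,\dots,D_k\}$ if and only if $B_i=D_j$ for some $i,j$. *)

(* Defs.v *)
From mathcomp Require Import all_boot.
Set Implicit Arguments. Unset Strict Implicit. Unset Printing Implicit Defensive.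

(* A finite multigraph (loops and parallel edges allowed): vertex type V,
   edge type E, and each edge e has endpoints (ends e).1, (ends e).2. *)
Section Graph.
Variables (V E : finType) (ends : E -> V * V).

Definition adjF (F : {set E}) : rel V :=
  fun x y => [exists e in F, (ends e == (x, y)) || (ends e == (y, x))].

(* degree of v in the subgraph spanned by F (a loop counts twice) *)
Definition degF (F : {set E}) (v : V) : nat :=
  #|[set e in F | (ends e).1 == v]| + #|[set e in F | (ends e).2 == v]|.

Definition is_cycle (C : {set E}) : Prop :=
  [/\ C != set0,
      forall v, (degF C v == 0) || (degF C v == 2)
    & forall e f, e \in C -> f \in C -> connect (adjF C) (ends e).1 (ends f).1].

Definition acyclic (F : {set E}) : Prop :=
  forall C : {set E}, C \subset F -> ~ is_cycle C.

Definition is_base (B : {set E}) : Prop :=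
  acyclic B /\ forall B' : {set E}, B \subset B' -> acyclic B' -> B' = B.

Definition ncomp : nat := n_comp (adjF [set: E]) predT.

Definition cycle_rank : nat := #|V| - ncomp.

Definition kbase_vertex (k : nat) (P : {set {set E}}) : Prop :=
  [/\ #|P| = k, forall B, B \in P -> is_base B & trivIset P].

Definition kbase_adj (k : nat) (P Q : {set {set E}}) : Prop :=
  [/\ kbase_vertex k P, kbase_vertex k Q & exists B, B \in P /\ B \in Q].

Inductive kbase_path (k : nat) : {set {set E}} -> {set {set E}} -> Prop :=
  | kbp_refl P : kbase_path k P P
  | kbp_step P Q R : kbase_adj k P Q -> kbase_path k Q R -> kbase_path k P R.

Definition kbase_graph_connected (k : nat) : Prop :=
  forall P Q, kbase_vertex k P -> kbase_vertex k Q -> kbase_path k P Q.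

End Graph.

(* Main.v *)
(* Gluing the components of the graph at one vertex makes the bases spanning
   trees; a family of [k] disjoint bases is then a colouring of the edges whose
   classes are spanning trees, and the proof is by induction on the number of
   vertices.  Some vertex [v] has degree [d = k + s] with [s < k].  Pairing up
   [2 s] of the edges at [v], deleting [v] and adding for every pair an edge
   between the two far ends gives a graph with one vertex less; each of its
   decompositions extends to one of the whole graph without recolouring the
   edges off [v], and any two decompositions that agree off [v] are connected,
   by rotating edges at [v] through a class where [v] is a leaf.  Hence, by
   induction, all decompositions compatible with one pairing are connected.
   Every decomposition is connected to one in which [v] has degree at most 2 in
   each tree, and such a decomposition is compatible with a pairing.  It remains
   to walk between pairings.  By the Nash-Williams arboricity theorem the
   admissible pairings are those satisfying a sparsity count, so an exchange of
   one pair is blocked only by a tight vertex set; uncrossing tight sets shows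
   that single exchanges connect all pairings, since an edge at [v] is always
   left unpaired.  An exchange of one pair for another is realised by a
   decomposition compatible with both. *)

Require Import Defs.
From mathcomp Require Import all_boot zify.
Set Implicit Arguments. Unset Strict Implicit. Unset Printing Implicit Defensive.

(** * Forests as edge sets all of whose edges are bridges *)

Section Forest.
Variables (V E : finType) (ends : E -> V * V).
Implicit Types (A B D : {set E}) (X Y : {set V}).

(** The assumption [2 < k] acts mainly through swaps: exchanging two edges between two classes
    leaves a third class untouched, so any swap that keeps both classes forests is a single step.
    The degree of [v] comes from averaging: [n] vertices carry [k (n - 1)] edges, so some degree is
    below [2 k], while each of the [k] trees needs an edge at [v]. Hence [v] is a leaf of some tree,
    and this leaf edge is the room in which the edges at [v] can be rotated. A decomposition of the
    smaller graph has many extensions to the whole graph. The choice is harmless, as extensions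
    equal off [v] are connected, but a step must be lifted to two decompositions that still share a
    class; therefore the edges at [v] of one class can be prescribed. The Nash-Williams theorem
    guarantees that every sparse pairing met on the walk comes from a decomposition, without which
    links between pairings could not be composed. *)

Definition con A (x y : V) := connect (adjF ends A) x y.

Definition forest A : Prop :=
  forall e, e \in A -> ~~ con (A :\ e) (ends e).1 (ends e).2.

Definition inn A X := [set e in A | ((ends e).1 \in X) && ((ends e).2 \in X)].

Lemma adjFP A x y :
  reflect (exists2 e, e \in A & ends e = (x, y) \/ ends e = (y, x))
          (adjF ends A x y).
Proof.
apply: (iffP existsP) => [[e /andP[eA /orP[/eqP h|/eqP h]]]|[e eA [h|h]]].
- by exists e => //; left.
- by exists e => //; right.
- by exists e; rewrite eA h eqxx.
- by exists e; rewrite eA h eqxx orbT.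
Qed.

Lemma con_refl A x : con A x x. Proof. exact: connect0. Qed.

Lemma con_sym A x y : con A x y = con A y x.
Proof.
apply: sym_connect_sym => {}x {}y.
by apply/adjFP/adjFP => -[e eA h]; exists e => //; case: h => h; by [right|left].
Qed.

Lemma con_trans A y x z : con A x y -> con A y z -> con A x z.
Proof. exact: connect_trans. Qed.

Lemma con_sub A B x y : A \subset B -> con A x y -> con B x y.
Proof.
move=> /subsetP AB; apply: connect_sub => {}x {}y /adjFP[e eA h].
by apply: connect1; apply/adjFP; exists e => //; apply: AB.
Qed.

Lemma con_edge A e : e \in A -> con A (ends e).1 (ends e).2.
Proof.
by move=> eA; apply: connect1; apply/adjFP; exists e => //; left; case: (ends e).
Qed.

Lemma con_closed A (C : pred V) x y :
  (forall e, e \in A -> C (ends e).1 = C (ends e).2) -> con A x y -> C x = C y.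
Proof.
move=> hC; have cl : closed (adjF ends A) C.
  by move=> a b /adjFP[e /hC]; rewrite !unfold_in => h [] he; rewrite he in h.
exact: (closed_connect cl).
Qed.

Lemma con_set0 x y : con set0 x y -> x = y.
Proof.
move=> h; apply/eqP; rewrite eq_sym; change (pred1 x y).
by rewrite -(con_closed (C := pred1 x) _ h) /= ?eqxx // => e; rewrite inE.
Qed.

Lemma con_setU1 A e x y : con (e |: A) x y ->
  [\/ con A x y, con A x (ends e).1 /\ con A (ends e).2 y
    | con A x (ends e).2 /\ con A (ends e).1 y].
Proof.
move=> h; set s := (ends e).1; set d := (ends e).2.
(* The component of [x] after adding [e]: what [A] alone reaches and, once an end of [e] is reached,
   whatever either end reaches. *)
pose C z := con A x z || ((con A x s || con A x d) && (con A s z || con A d z)).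
have CA f z : f \in A -> con A z (ends f).1 = con A z (ends f).2.
  move=> fA; apply/idP/idP => h'; first exact: con_trans h' (con_edge fA).
  by apply: con_trans h' _; rewrite con_sym con_edge.
have : C y.
  rewrite -(con_closed (C := C) _ h) /C ?con_refl // => f.
  rewrite !inE => /orP[/eqP->|fA]; last by rewrite !(CA f).
  rewrite -/s -/d !con_refl !orbT !andbT.
  by case: (con A x s); case: (con A x d).
case/orP=> [h1|/andP[/orP[h1|h1] /orP[h2|h2]]].
- by constructor 1.
- by constructor 1; apply: con_trans h1 h2.
- by constructor 2.
- by constructor 3.
- by constructor 1; apply: con_trans h1 h2.
Qed.

Lemma con_absorb A e x y :
  con A (ends e).1 (ends e).2 -> con (e |: A) x y -> con A x y.
Proof.
move=> he /con_setU1[//|[h1 h2]|[h1 h2]]; apply: con_trans h1 _.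
  exact: con_trans he h2.
by rewrite con_sym in he; apply: con_trans he h2.
Qed.

Lemma inn_sub A X : inn A X \subset A.
Proof. by apply/subsetP => e; rewrite inE => /andP[]. Qed.

Lemma con_inn A X x y :
  (forall e, e \in A -> ((ends e).1 \in X) = ((ends e).2 \in X)) ->
  x \in X -> con A x y -> con (inn A X) x y.
Proof.
move=> hX xX h; have hX' z : con (inn A X) x z -> z \in X.
  move=> h'; change (mem X z); rewrite -(con_closed (C := mem X) _ h') // => e.
  by rewrite inE => /andP[/hX].
rewrite -(con_closed (C := con (inn A X) x) _ h) ?con_refl // => e eA.
apply/idP/idP => h'.
  apply: con_trans (h') _; apply: con_edge; rewrite inE eA /= -hX //.
  by rewrite (hX' _ h').
apply: con_trans (h') _; rewrite con_sym; apply: con_edge.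
by rewrite inE eA /= hX // (hX' _ h').
Qed.

Lemma forest_sub A B : A \subset B -> forest B -> forest A.
Proof.
move=> AB fB e eA; apply: contra (fB e (subsetP AB e eA)).
by apply: con_sub; apply: setSD.
Qed.

Lemma forest0 : forest set0. Proof. by move=> e; rewrite inE. Qed.

Lemma forest_setU1 A e :
  forest A -> ~~ con A (ends e).1 (ends e).2 -> forest (e |: A).
Proof.
move=> fA ne f; rewrite !inE => /orP[/eqP->|fA'].
  apply: contra ne; apply: con_sub; apply/subsetP => g.
  by rewrite !inE => /andP[/negbTE->].
have nef : f != e by apply: contraNneq ne => <-; apply: con_edge.
have -> : (e |: A) :\ f = e |: A :\ f.
  by apply/setP => g; rewrite !inE; case: (eqVneq g e) => // ->; rewrite eq_sym nef.
have sub : A :\ f \subset A by apply: subD1set.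
apply/negP => /con_setU1[h|[h1 h2]|[h1 h2]].
- by move: (fA f fA'); rewrite h.
- case/negP: ne; rewrite con_sym; apply: con_trans (con_sub sub h2) _.
  by rewrite con_sym; apply: con_trans (con_edge fA'); rewrite con_sym (con_sub sub).
- case/negP: ne; apply: con_trans (con_sub sub h2) _.
  by rewrite con_sym; apply: con_trans (con_edge fA'); rewrite con_sym (con_sub sub).
Qed.

(** The forest has a unique path from [x] to [y]; it uses an edge of [D], and deleting that edge
    alone already separates. The proof shrinks [D] until putting back one edge restores the
    connection. *)
Lemma essential_edge A D x y : forest A -> con A x y ->
  ~~ con (A :\: D) x y ->
  exists g, [/\ g \in D, g \in A & ~~ con (A :\ g) x y].
Proof.
move=> fA cA; have [n] := ubnP #|D|; elim: n D => // n IH D leD nD.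
have [D0|[g gD]] := set_0Vmem D; first by move: nD; rewrite D0 setD0 cA.
have [cg|ng] := boolP (con (A :\: (D :\ g)) x y); last first.
  case: (IH (D :\ g)) => //; first by move: leD; rewrite (cardsD1 g D) gD.
  by move=> g' [g'D g'A h]; exists g'; split=> //; move: g'D; rewrite inE => /andP[].
have [gA|gA] := boolP (g \in A); last first.
  case/negP: nD; apply: con_sub cg; apply/subsetP => f.
  by rewrite !inE; case: (eqVneq f g) => // ->; rewrite (negbTE gA) andbF.
exists g; split=> //; apply/negP => cAg; case/negP: (fA g gA).
have eqB : A :\: (D :\ g) = g |: (A :\: D).
  by apply/setP => f; rewrite !inE negb_and negbK andb_orl; case: (eqVneq f g) => //= ->; rewrite gA.
have sub : A :\: D \subset A :\ g.
  apply/subsetP => f; rewrite !inE => /andP[fD ->]; rewrite andbT.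
  by apply: contraNneq fD => ->.
rewrite eqB in cg; case/con_setU1: cg => [h|[/(con_sub sub) h1 /(con_sub sub) h2]|[/(con_sub sub) h1 /(con_sub sub) h2]].
- by rewrite h in nD.
- rewrite con_sym in h1; apply: con_trans h1 _; apply: con_trans cAg _.
  by rewrite con_sym.
- apply: con_trans h2 _; rewrite con_sym; apply: con_trans cAg.
  by rewrite con_sym.
Qed.

(** * Edge counts of forests inside a vertex set *)

Lemma inn_split A X (C : pred V) :
  (forall e, e \in A -> C (ends e).1 = C (ends e).2) ->
  inn A X = inn A [set z in X | C z] :|: inn A [set z in X | ~~ C z].
Proof.
move=> h; apply/setP => e; rewrite !inE.
case eA: (e \in A) => //=; rewrite h //.
by case: (C _); rewrite /= ?andbT ?andbF ?orbF.
Qed.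

Lemma inn_split_card A X (C : pred V) :
  (forall e, e \in A -> C (ends e).1 = C (ends e).2) ->
  #|inn A X| = #|inn A [set z in X | C z]| + #|inn A [set z in X | ~~ C z]|.
Proof.
move=> h; rewrite (inn_split _ h) cardsU (_ : _ :&: _ = set0) ?cards0 ?subn0 //.
apply/setP => e; rewrite !inE; case: (e \in A) => //=.
by case: (C _); rewrite /= ?andbF.
Qed.

Lemma card_split X (C : pred V) :
  #|X| = #|[set z in X | C z]| + #|[set z in X | ~~ C z]|.
Proof.
rewrite -(cardsID [set z | C z] X); congr (_ + _); apply: eq_card => z.
  by rewrite !inE.
by rewrite !inE andbC.
Qed.

Lemma con_set_closed A x e :
  e \in A -> con A x (ends e).1 = con A x (ends e).2.
Proof.
move=> eA; apply/idP/idP => h; apply: con_trans h _; first exact: con_edge.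
by rewrite con_sym con_edge.
Qed.

(** A bridge [e] inside [X] splits [X] into the part still joined to its first end and the
    remainder; both are nonempty, and their bounds add up. *)
Lemma forest_card A X : forest A -> X != set0 -> #|inn A X| < #|X|.
Proof.
have [n] := ubnP #|X|; elim: n X A => // n IH X A leX fA X0.
have [->|[e eA]] := set_0Vmem (inn A X); first by rewrite cards0 card_gt0.
move: (eA); rewrite inE => /and3P[eA' e1X e2X].
pose C := con (A :\ e) (ends e).1.
have hC f : f \in A :\ e -> C (ends f).1 = C (ends f).2 by apply: con_set_closed.
have -> : inn A X = e |: inn (A :\ e) X.
  by apply/setP => f; rewrite !inE; case: eqVneq => //= ->; rewrite eA' e1X e2X.
rewrite cardsU1 inE in_setD1 eqxx /= (inn_split_card _ hC) (card_split X C).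
have fA' : forest (A :\ e) by apply: forest_sub fA; apply: subD1set.
have h1 : [set z in X | C z] != set0.
  by apply/set0Pn; exists (ends e).1; rewrite inE e1X /C con_refl.
have h2 : [set z in X | ~~ C z] != set0.
  by apply/set0Pn; exists (ends e).2; rewrite inE e2X /=; apply: fA.
have := card_split X C; rewrite -!card_gt0 in h1 h2.
have /(_ (A :\ e) _ fA') := IH [set z in X | C z]; rewrite -card_gt0.
have /(_ (A :\ e) _ fA') := IH [set z in X | ~~ C z]; rewrite -card_gt0.
by lia.
Qed.

(** A separation of [X] would give two nonempty parts, each with fewer edges than vertices, which is
    one edge too few in total. *)
Lemma forest_card_con A X x y : forest A -> #|X| <= #|inn A X|.+1 ->
  x \in X -> y \in X -> con (inn A X) x y.
Proof.
move=> fA leX xX yX; apply/negPn/negP => nc.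
pose B := inn A X; pose C := con B x.
have hC f : f \in B -> C (ends f).1 = C (ends f).2 by apply: con_set_closed.
have fB : forest B by apply: forest_sub fA; apply: inn_sub.
have BB : inn B X = B.
  by apply/setP => f; rewrite !inE; case: (f \in A); rewrite //= andbb.
have := inn_split_card X hC; rewrite BB.
have h1 : [set z in X | C z] != set0.
  by apply/set0Pn; exists x; rewrite inE xX /C con_refl.
have h2 : [set z in X | ~~ C z] != set0.
  by apply/set0Pn; exists y; rewrite inE yX.
have := forest_card fB h1; have := forest_card fB h2.
by have := card_split X C; move: leX; rewrite -/B; lia.
Qed.

Lemma con_card_forest A X : forest A -> 
  (forall x y, x \in X -> y \in X -> con (inn A X) x y) -> #|X| <= #|inn A X|.+1.
Proof.
have [n] := ubnP #|X|; elim: n X A => // n IH X A leX fA cX.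
have [A0|[e eA]] := set_0Vmem (inn A X).
  rewrite A0 cards0; rewrite leqNgt; apply/negP => /card_gt1P[x [y [xX yX]]].
  by case/eqP; apply: con_set0; rewrite -A0; apply: cX.
move: (eA); rewrite inE => /and3P[eA' e1X e2X].
pose B := inn (A :\ e) X.
have eqA : inn A X = e |: B.
  by apply/setP => f; rewrite !inE; case: eqVneq => //= ->; rewrite eA' e1X e2X.
pose C := con B (ends e).1.
have hC f : f \in B -> C (ends f).1 = C (ends f).2 by apply: con_set_closed.
have fA' : forest (A :\ e) by apply: forest_sub fA; apply: subD1set.
have fB : forest B by apply: forest_sub fA'; apply: inn_sub.
have BB : inn B X = B.
  apply/setP => f; rewrite !inE.
  by case: (f != e); case: (f \in A); rewrite //= andbb.
have nC2 : ~~ C (ends e).2.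
  by apply: contra (fA e eA'); apply: con_sub; apply: inn_sub.
have BX f : f \in B -> ((ends f).1 \in X) && ((ends f).2 \in X) by rewrite inE => /andP[].
have := card_split X C; have := inn_split_card X hC; rewrite BB => c1 c2.
have p1 : 0 < #|[set z in X | C z]|.
  by apply/card_gt0P; exists (ends e).1; rewrite inE e1X /C con_refl.
have p2 : 0 < #|[set z in X | ~~ C z]|.
  by apply/card_gt0P; exists (ends e).2; rewrite inE e2X.
have eB : e \notin B by rewrite !inE eqxx.
rewrite eqA cardsU1 eB.
have l1 : #|[set z in X | C z]| <= #|inn B [set z in X | C z]|.+1.
  apply: IH => //; first by lia.
  move=> x y; rewrite !inE => /andP[xX Cx] /andP[yX Cy]; apply: con_inn.
  - by move=> f fB'; move: (BX _ fB') => /andP[h1 h2]; rewrite !inE h1 h2 /= hC.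
  - by rewrite inE xX.
  - by rewrite /C con_sym in Cx; apply: con_trans Cx Cy.
have toe z : z \in X -> ~~ C z -> con B (ends e).2 z.
  move=> zX Cz; have := cX _ _ e1X zX; rewrite eqA => /con_setU1[h|[_ //]|[h _]].
  - by move: Cz; rewrite /C h.
  - by move: nC2; rewrite /C h.
have l2 : #|[set z in X | ~~ C z]| <= #|inn B [set z in X | ~~ C z]|.+1.
  apply: IH => //; first by lia.
  move=> x y; rewrite !inE => /andP[xX Cx] /andP[yX Cy]; apply: con_inn.
  - by move=> f fB'; move: (BX _ fB') => /andP[h1 h2]; rewrite !inE h1 h2 /= hC.
  - by rewrite inE xX.
  - by have := toe _ xX Cx; rewrite con_sym => h; apply: con_trans h (toe _ yX Cy).
by lia.
Qed.

End Forest.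

(** * Decompositions into [k] forests *)

Section Decomposition.
Variables (V E : finType) (ends : E -> V * V) (k : nat).
Implicit Types (J K S : {set E}) (X Y : {set V}) (c : E -> 'I_k) (i j : 'I_k).

Definition cls S c i := [set e in S | c e == i].

Definition dec S c : Prop := forall i, forest ends (cls S c i).

(** The arboricity count of Nash-Williams; on a single vertex it forbids loops. *)
Definition sparse S := forall X, X != set0 -> #|inn ends S X| <= k * #|X|.-1.

Lemma card_cls S c : #|S| = \sum_i #|cls S c i|.
Proof.
rewrite -sum1_card (partition_big c predT) //=; apply: eq_bigr => i _.
by rewrite -sum1_card; apply: eq_bigl => e; rewrite inE.
Qed.

Lemma cls_inn S c i X : inn ends (cls S c i) X = cls (inn ends S X) c i.
Proof. by apply/setP => e; rewrite !inE andbAC. Qed.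

Lemma dec_sparse S c : dec S c -> sparse S.
Proof.
move=> dc X X0; rewrite (card_cls _ c) -[X in X * _]card_ord -sum_nat_const.
apply: leq_sum => i _; rewrite -cls_inn.
by have := forest_card (dc i) X0; lia.
Qed.

(** Search structure for a missing edge with ends [x] and [y]: nested vertex sets, each the
    component of [x] in some class restricted to the previous set, and all containing [y]. The
    length [r] is the measure that drops when edges are traded. *)
Inductive chain S c (x y : V) : nat -> {set V} -> Prop :=
| chain0 : chain S c x y 0 setT
| chainS r X i : chain S c x y r X -> con ends (inn ends (cls S c i) X) x y ->
    chain S c x y r.+1 [set z in X | con ends (inn ends (cls S c i) X) x z].

Lemma chain_mem S c x y r X : chain S c x y r X -> x \in X /\ y \in X.
Proof.
elim=> [|{}r {}X i _ [xX yX] h]; first by rewrite !inE.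
by rewrite !inE xX yX h con_refl.
Qed.

(* [g] is an edge of class [j] that separates the ends of the missing edge [e]
   and sticks out of [X]; trading [g] for [e] leaves the chain valid up to the
   first set that does not contain [g]. *)
Lemma chain_trade K c e g j r X : e \in K -> g \in K -> g != e -> c g = j ->
  let c' := [eta c with e |-> j] in
  ~~ con ends (cls (K :\ e) c j :\ g) (ends e).1 (ends e).2 ->
  chain (K :\ e) c (ends e).1 (ends e).2 r X ->
  ((ends g).1 \in X) || ((ends g).2 \in X) ->
  (((ends g).1 \in X) && ((ends g).2 \in X) /\
    chain (K :\ g) c' (ends g).1 (ends g).2 r X) \/
  exists r' X' i, [/\ r' < r, chain (K :\ g) c' (ends g).1 (ends g).2 r' X' &
    ~~ con ends (inn ends (cls (K :\ g) c' i) X') (ends g).1 (ends g).2].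
Proof.
move=> eK gK nge cg c' nA; elim=> [|{}r {}X i ch IH cx].
  by left; rewrite !inE; split=> //; apply: chain0.
set A := inn ends (cls (K :\ e) c i) X in cx *.
set A' := inn ends (cls (K :\ g) c' i) X.
move=> gX1; have gX : ((ends g).1 \in X) || ((ends g).2 \in X).
  by move: gX1; rewrite !inE => /orP[/andP[->]|/andP[->]] //; rewrite orbT.
case: (IH gX) => [[gX2 ch']|[r' [X' [i' [lt ch' h]]]]]; last first.
  by right; exists r', X', i'; split=> //; apply: leq_trans lt _.
have [exX eyX] := chain_mem ch.
have [cg'|ncg] := boolP (con ends A' (ends g).1 (ends g).2); last first.
  by right; exists r, X, i; split.
suff [eqA a1] : (forall z, con ends A (ends e).1 z = con ends A' (ends g).1 z) /\
                con ends A (ends e).1 (ends g).1.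
  left; split.
    rewrite !inE; case/andP: gX2 => -> ->.
    by rewrite a1 eqA cg'.
  have -> : [set z in X | con ends A (ends e).1 z] =
            [set z in X | con ends A' (ends g).1 z].
    by apply/setP => z; rewrite !inE eqA.
  exact: chainS.
have [eij|nij] := eqVneq i j; last first.
  have nji : (j == i) = false by rewrite eq_sym (negbTE nij).
  have eqA : A = A'.
    apply/setP => f; rewrite !inE /=; case: (eqVneq f e) => [->|_] /=.
      by rewrite nji !andbF.
    by case: (eqVneq f g) => [->|//]; rewrite cg nji !andbF.
  have a1 : con ends A (ends e).1 (ends g).1.
    move: gX1; rewrite !inE => /orP[/andP[]//|/andP[_ h]].
    by apply: con_trans h _; rewrite con_sym eqA.
  split=> // z; rewrite -eqA; apply/idP/idP => h; last exact: con_trans a1 h.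
  by apply: con_trans h; rewrite con_sym.
subst i; pose B := A :\ g.
have gA : g \in A by rewrite !inE nge gK cg eqxx.
have eA : A = g |: B by rewrite /B setD1K.
have eA' : A' = e |: B.
  apply/setP => f; rewrite !inE /=; case: (eqVneq f e) => [->|_] /=.
    by rewrite eq_sym nge eK eqxx exX eyX.
  by case: (eqVneq f g).
have nB : ~~ con ends B (ends e).1 (ends e).2.
  by apply: contra nA; apply: con_sub; apply: setSD; apply: inn_sub.
have sB : B \subset A by rewrite eA subsetUr.
have sB' : B \subset A' by rewrite eA' subsetUr.
have a1 : con ends A (ends e).1 (ends g).1.
  move: cx; rewrite {1}eA => /con_setU1[h|[h _]|[h _]].
  - by rewrite h in nB.
  - exact: con_sub h.
  - by apply: con_trans (con_sub sB h) _; rewrite con_sym con_edge.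
have e' : con ends A' (ends e).1 (ends e).2 by apply: con_edge; rewrite eA' setU11.
have a1' : con ends A' (ends e).1 (ends g).1.
  move: cx; rewrite {1}eA => /con_setU1[h|[h _]|[_ h]].
  - by rewrite h in nB.
  - exact: con_sub h.
  - by apply: con_trans e' _; rewrite con_sym; apply: con_sub h.
split=> // z; apply/idP/idP => h.
  have h' : con ends A' (ends e).1 z.
    apply: (con_absorb (e := g)) => //; apply: con_sub h.
    by rewrite eA setUS.
  by apply: con_trans h'; rewrite con_sym.
have h' := con_trans a1' h.
apply: (con_absorb (e := e)) => //; apply: con_sub h'.
by rewrite eA' setUS.
Qed.

Lemma cls_recolor K c e g j : e \in K -> g \in K -> g != e -> c g = j ->
  forall i, cls (K :\ g) [eta c with e |-> j] i =
    if i == j then e |: (cls (K :\ e) c j :\ g) else cls (K :\ e) c i.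
Proof.
move=> eK gK nge cg i; have neg : e != g by rewrite eq_sym.
apply/setP => f; case: (eqVneq i j) => [->|nij]; rewrite !inE /=.
  have [->|nfe] := eqVneq f e; first by rewrite neg eK eqxx.
  by have [->|nfg] := eqVneq f g.
have nji : (j == i) = false by rewrite eq_sym (negbTE nij).
have [->|nfe] := eqVneq f e; first by rewrite nji andbF.
by have [->|//] := eqVneq f g; rewrite cg nji !andbF.
Qed.

(** Either [e] fits into class [i], or the path of class [i] between its ends crosses the boundary
    of [X] by an edge [g]. Giving [e] the colour of [g] makes [g] the missing edge, and its chain
    breaks at a smaller length. *)
Lemma chain_augment K r : forall c e X i, e \in K -> dec (K :\ e) c ->
  chain (K :\ e) c (ends e).1 (ends e).2 r X ->
  ~~ con ends (inn ends (cls (K :\ e) c i) X) (ends e).1 (ends e).2 ->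
  exists c', dec K c'.
Proof.
have [n] := ubnP r; elim: n r => // n IH r ler c e X i eK dc ch nc.
set A := cls (K :\ e) c i in nc.
have [cA|ncA] := boolP (con ends A (ends e).1 (ends e).2); last first.
  exists [eta c with e |-> i] => j.
  have -> : cls K [eta c with e |-> i] j =
            if j == i then e |: A else cls (K :\ e) c j.
    apply/setP => f; case: (eqVneq j i) => [->|nji]; rewrite !inE /=.
      by have [->|nfe] := eqVneq f e; rewrite ?eK ?eqxx.
    by have [->|//] := eqVneq f e; rewrite eq_sym (negbTE nji) andbF.
  by case: eqP => // _; apply: forest_setU1 => //; apply: dc.
have [eX1 eX2] := chain_mem ch.
pose D := [set f in A | ((ends f).1 \in X) != ((ends f).2 \in X)].
have nD : ~~ con ends (A :\: D) (ends e).1 (ends e).2.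
  apply: contra nc => h; apply: (@con_sub _ _ _ (inn ends (A :\: D) X)).
    apply/subsetP => f; rewrite inE => /andP[].
    by rewrite inE => /andP[_ fA] fX; rewrite inE fA.
  apply: con_inn => // f; rewrite !inE => /andP[].
  by rewrite negb_and negbK => /orP[/negP h'|/eqP//] /h'.
have [g [gD gA ng]] := essential_edge (dc i) cA nD.
move: (gA); rewrite !inE => /andP[/andP[nge gK] /eqP cg].
have gX : ((ends g).1 \in X) || ((ends g).2 \in X).
  by move: gD; rewrite inE => /andP[_]; do 2 case: (_ \in X).
have ngX : ~~ (((ends g).1 \in X) && ((ends g).2 \in X)).
  by move: gD; rewrite inE => /andP[_]; do 2 case: (_ \in X).
case: (chain_trade eK gK nge cg ng ch gX) => [[h _]|]; first by rewrite h in ngX.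
case=> r' [X' [i' [lt ch' nc']]].
apply: (IH r' _ _ g X' i' gK _ ch' nc'); first by rewrite ltnS in ler; apply: leq_trans lt ler.
move=> j; rewrite (cls_recolor eK gK nge cg); case: eqP => // _.
by apply: forest_setU1 => //; apply: forest_sub (dc i); apply: subD1set.
Qed.

(** While some class fails to connect the current set, the chain either yields an augmentation or
    continues with a strictly smaller set. When it stops, every class spans [X], which makes [X]
    tight. *)
Lemma augment_or_tight K c e : e \in K -> dec (K :\ e) c ->
  (exists c', dec K c') \/
  exists X, [/\ (ends e).1 \in X, (ends e).2 \in X &
                k * #|X|.-1 <= #|inn ends (K :\ e) X|].
Proof.
move=> eK dc.
suff [h|[r [X [ch h]]]] : (exists c', dec K c') \/ exists r X,
    chain (K :\ e) c (ends e).1 (ends e).2 r X /\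
    forall i z, z \in X -> con ends (inn ends (cls (K :\ e) c i) X) (ends e).1 z.
- by left.
- right; exists X; have [h1 h2] := chain_mem ch; split=> //.
  rewrite (card_cls _ c) -[k in k * _]card_ord -sum_nat_const.
  apply: leq_sum => i _; rewrite -cls_inn.
  suff : #|X| <= #|inn ends (cls (K :\ e) c i) X|.+1 by lia.
  apply: con_card_forest => // x y xX yX.
  by apply: con_trans (h i y yX); rewrite con_sym h.
(* Here [n] counts the vertices lost so far; [n = #|V|.+1] makes the last alternative impossible. *)
suff main n : (exists c', dec K c') \/
    (exists r X, chain (K :\ e) c (ends e).1 (ends e).2 r X /\
    forall i z, z \in X -> con ends (inn ends (cls (K :\ e) c i) X) (ends e).1 z) \/
    exists r X, chain (K :\ e) c (ends e).1 (ends e).2 r X /\ #|X| + n <= #|V|.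
  case: (main #|V|.+1) => [|[|[r [X [ch]]]]]; [by left|by right|by lia].
elim: n => [|n [|[|[r [X [ch leX]]]]]]; [|by left|by right; left|].
  right; right; exists 0, setT; split; first exact: chain0.
  by rewrite addn0 cardsT.
pose A i := inn ends (cls (K :\ e) c i) X.
have [/forallP hX|] := boolP [forall i, [forall (z | z \in X), con ends (A i) (ends e).1 z]].
  right; left; exists r, X; split=> // i z zX.
  by move: (hX i) => /forallP/(_ z); rewrite zX.
rewrite negb_forall => /existsP[i]; rewrite negb_forall => /existsP[z].
rewrite negb_imply => /andP[zX nz].
have [cA|ncA] := boolP (con ends (A i) (ends e).1 (ends e).2); last first.
  by left; apply: chain_augment ch ncA.
right; right; exists r.+1, [set z in X | con ends (A i) (ends e).1 z].
split; first exact: chainS.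
suff : #|[set z in X | con ends (A i) (ends e).1 z]| < #|X| by lia.
apply: proper_card; apply/properP; split.
  by apply/subsetP => w; rewrite inE => /andP[].
by exists z => //; rewrite inE zX.
Qed.

(** The Nash-Williams theorem, one edge at a time: a tight set around the ends of [e] would exceed
    the count once [e] is included. *)
Lemma sparse_dec S : 0 < k -> sparse S -> exists c, dec S c.
Proof.
move=> k0; have [n] := ubnP #|S|; elim: n S => // n IH S leS sS.
have [->|[e eS]] := set_0Vmem S.
  exists (fun _ => Ordinal k0) => i; apply: forest_sub (@forest0 _ _ ends).
  by apply/subsetP => f; rewrite !inE.
have sS' : sparse (S :\ e).
  move=> X /sS; apply: leq_trans; apply: subset_leq_card.
  by apply/subsetP => f; rewrite !inE => /andP[/andP[_ ->] ->].
case: (IH (S :\ e) _ sS'); first by move: leS; rewrite (cardsD1 e S) eS.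
move=> c dc; case: (augment_or_tight eS dc) => // -[X [x1 x2 le]].
have X0 : X != set0 by apply/set0Pn; exists (ends e).1.
have := sS X X0; have -> : inn ends S X = e |: inn ends (S :\ e) X.
  by apply/setP => f; rewrite !inE; case: eqVneq => //= ->; rewrite eS x1 x2.
by rewrite cardsU1 !inE eqxx /=; lia.
Qed.

Lemma family_colouring S (T : 'I_k -> {set E}) : 0 < k -> 
  (forall i, T i \subset S) -> (forall e, e \in S -> exists i, e \in T i) ->
  (forall i j e, e \in T i -> e \in T j -> i = j) ->
  exists c, forall i, cls S c i = T i.
Proof.
(* The default colour is given only to elements outside all [T i], hence outside [S]. *)
move=> k0 TS cov dis; exists (fun e => odflt (Ordinal k0) [pick i | e \in T i]).
move=> i; apply/setP => e; rewrite inE; case: pickP => [j eTj|h] /=.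
  rewrite (subsetP (TS j) _ eTj) /=; apply/eqP/idP => [<- //|eTi].
  exact: dis eTj eTi.
by rewrite h; case: (boolP (e \in S)) => //= /cov[j]; rewrite h.
Qed.

End Decomposition.

(** * Exchanging pairs in sparse matchings *)

Section Matchings.
Variables (V D : finType) (u : D -> V) (tk : {set D}) (k : nat).
Variable load : {set V} -> nat.
Hypothesis load_super : forall X Y, load X + load Y <= load (X :|: Y) + load (X :&: Y).
Implicit Types (F G C Q : seq (D * D)) (p q : D * D) (X Y : {set V}) (x y z : D).

(** In the application [D] is the type of edges, [tk] the set of those at [v], [u] gives the far
    end, and [load X] counts the edges off [v] inside [X]. A pairing is a list of ordered pairs;
    permuting the list and reversing a pair have to be accounted for as moves. *)
Definition pts F := map fst F ++ map snd F.

Definition cnt F X := count (fun p => (u p.1 \in X) && (u p.2 \in X)) F.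

Definition sparsef F := [forall X, (X != set0) ==> (load X + cnt F X <= k * #|X|.-1)].

Definition tight F X := load X + cnt F X == k * #|X|.-1.

Definition matching F := uniq (pts F) && all (mem tk) (pts F).

Definition valid F := matching F && sparsef F.

Lemma mem_pts_cons x p F : x \in pts (p :: F) = [|| x == p.1, x == p.2 | x \in pts F].
Proof. by rewrite /pts !mem_cat !inE -!orbA; congr (_ || _); rewrite orbCA. Qed.

Lemma mem_pts_cat x F G : x \in pts (F ++ G) = (x \in pts F) || (x \in pts G).
Proof. by rewrite /pts !map_cat !mem_cat orbACA. Qed.

Lemma matching_cons p F : matching (p :: F) =
  [&& p.1 != p.2, p.1 \in tk, p.2 \in tk, p.1 \notin pts F, p.2 \notin pts F & matching F].
Proof.
have e : perm_eq (pts (p :: F)) [:: p.1, p.2 & pts F].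
  by rewrite /pts /= perm_cons perm_catC /= perm_cons perm_catC.
rewrite /matching (perm_uniq e) (perm_all _ e) /= inE negb_or -!andbA.
by case: (p.1 == p.2); case: (p.1 \in tk); case: (p.2 \in tk);
  case: (p.1 \in pts F); case: (p.2 \in pts F); rewrite /= ?andbF ?andbT.
Qed.

Lemma size_pts F : size (pts F) = 2 * size F.
Proof. by rewrite size_cat !size_map mul2n addnn. Qed.

Lemma perm_pts F G : perm_eq F G -> perm_eq (pts F) (pts G).
Proof. by move=> h; apply: perm_cat; apply: perm_map. Qed.

Lemma perm_pts_cat F G : perm_eq (pts (F ++ G)) (pts F ++ pts G).
Proof. by rewrite /pts !map_cat perm_catACA. Qed.

Lemma sparsef_perm F G : perm_eq F G -> sparsef F = sparsef G.
Proof. by move=> h; apply: eq_forallb => X; rewrite /cnt (seq.permP h). Qed.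

Lemma matching_perm F G : perm_eq F G -> matching F = matching G.
Proof.
by move=> h; rewrite /matching (perm_uniq (perm_pts h)) (perm_all _ (perm_pts h)).
Qed.

Lemma valid_perm F G : perm_eq F G -> valid F = valid G.
Proof. by move=> h; rewrite /valid (matching_perm h) (sparsef_perm h). Qed.

Lemma cnt_cons p F X : cnt (p :: F) X = ((u p.1 \in X) && (u p.2 \in X)) + cnt F X.
Proof. by []. Qed.

Lemma cnt_super F X Y : cnt F X + cnt F Y <= cnt F (X :|: Y) + cnt F (X :&: Y).
Proof.
elim: F => // p F IH; rewrite !cnt_cons !inE.
by move: IH; case: (u p.1 \in X); case: (u p.1 \in Y); case: (u p.2 \in X);
  case: (u p.2 \in Y) => /=; lia.
Qed.

Lemma sparsefP F : reflect (forall X, X != set0 -> load X + cnt F X <= k * #|X|.-1) (sparsef F).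
Proof. by apply: (iffP forallP) => h X; [move/implyP: (h X)|apply/implyP; apply: h]. Qed.

Lemma sparsef_cons p F : sparsef (p :: F) -> sparsef F.
Proof.
move=> /sparsefP h; apply/sparsefP => X /h; rewrite cnt_cons.
by apply: leq_trans; rewrite leq_add2l leq_addl.
Qed.

Lemma sparsef_add p F : sparsef F -> ~~ sparsef (p :: F) ->
  exists X, [/\ tight F X, u p.1 \in X & u p.2 \in X].
Proof.
move=> /sparsefP sF; rewrite negb_forall => /existsP[X]; rewrite negb_imply => /andP[X0].
move: (sF _ X0); rewrite -ltnNge cnt_cons; case hp: (_ && _) => /= h1 h2; last by lia.
by case/andP: hp => h3 h4; exists X; rewrite /tight; split=> //; lia.
Qed.

Lemma sparsef_over p F X : sparsef (p :: F) -> tight F X -> u p.1 \in X -> u p.2 \in X -> False.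
Proof.
move=> /sparsefP sF /eqP tF h1 h2; have X0 : X != set0 by apply/set0Pn; exists (u p.1).
by move: (sF _ X0); rewrite cnt_cons h1 h2 /=; lia.
Qed.

(** Uncrossing: [load] and [cnt] are supermodular, while [k (|X| - 1)] is modular on sets that meet;
    equality is therefore forced on the union and the intersection. *)
Lemma tightUI F X Y w : sparsef F -> tight F X -> tight F Y -> w \in X -> w \in Y ->
  tight F (X :|: Y) /\ tight F (X :&: Y).
Proof.
move=> /sparsefP sF /eqP tX /eqP tY wX wY.
have i0 : 0 < #|X :&: Y| by apply/card_gt0P; exists w; rewrite inE wX.
have u0 : 0 < #|X :|: Y| by apply/card_gt0P; exists w; rewrite inE wX.
have x0 : 0 < #|X| by apply/card_gt0P; exists w.
have y0 : 0 < #|Y| by apply/card_gt0P; exists w.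
have := sF (X :&: Y); have := sF (X :|: Y); rewrite -!card_gt0 => /(_ u0) h1 /(_ i0) h2.
have := cnt_super F X Y; have := load_super X Y.
have := cardsUI X Y; rewrite /tight.
have : k * #|X|.-1 + k * #|Y|.-1 = k * #|X :|: Y|.-1 + k * #|X :&: Y|.-1.
  by have := cardsUI X Y; rewrite -!mulnDr => h; congr (_ * _); lia.
by move=> h3 _ h4 h5; split; apply/eqP; lia.
Qed.

(* Lying in a common tight set is transitive, as tight sets are closed under
   unions of intersecting pairs. *)
Lemma sparsef_alt x y z F : sparsef ((x, y) :: F) ->
  sparsef ((x, z) :: F) || sparsef ((y, z) :: F).
Proof.
move=> sxy; have sF := sparsef_cons sxy; apply/negPn/negP; rewrite negb_or.
case/andP=> /(sparsef_add sF)[X [tX /= xX zX]] /(sparsef_add sF)[Y [tY /= yY zY]].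
have [t _] := tightUI sF tX tY zX zY.
by apply: (sparsef_over sxy t); rewrite inE /= ?xX ?yY ?orbT.
Qed.

Lemma sparsef_swap x y F : sparsef ((x, y) :: F) = sparsef ((y, x) :: F).
Proof. by apply: eq_forallb => X; rewrite !cnt_cons /= andbC. Qed.

Lemma min_tight F (x y : V) : (exists X, [/\ tight F X, x \in X & y \in X]) ->
  exists X, [/\ tight F X, x \in X, y \in X & forall Y, tight F Y -> x \in Y -> y \in Y ->
    #|X| <= #|Y|].
Proof.
case=> X0 [t0 x0 y0]; pose P Y := [&& tight F Y, x \in Y & y \in Y].
have PX0 : P X0 by apply/and3P.
case: (arg_minnP (fun Y => #|Y|) PX0) => X /and3P[tX xX yX] m.
by exists X; split=> // Y tY xY yY; apply: m; apply/and3P.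
Qed.

(** The intersection with [Y] is tight as well, so minimality forces it to be all of [X]. *)
Lemma tight_min_sub F X Y (x y : V) : sparsef F -> tight F X -> x \in X -> y \in X ->
  (forall Z, tight F Z -> x \in Z -> y \in Z -> #|X| <= #|Z|) ->
  tight F Y -> x \in Y -> y \in Y -> X \subset Y.
Proof.
move=> sF tX xX yX m tY xY yY; have [_ t] := tightUI sF tX tY xX xY.
have le : #|X| <= #|X :&: Y| by apply: m; rewrite // inE ?xX ?yX.
have /eqP : X :&: Y == X by rewrite eqEcard subsetIl.
by move=> <-; apply: subsetIr.
Qed.

(** * Walks through pairings of size [s] under an abstract link relation *)

Variables (s : nat) (lk : seq (D * D) -> seq (D * D) -> Prop).
Hypothesis tk_big : 2 * s < #|tk|.
Hypothesis lk_perm : forall F G, valid F -> size F = s -> perm_eq F G -> lk F G.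
Hypothesis lk_exch : forall p q G, (size G).+1 = s -> valid (p :: G) -> valid (q :: G) ->
  lk (p :: G) (q :: G).
Hypothesis lk_trans : forall F G Q, valid G -> size G = s -> lk F G -> lk G Q -> lk F Q.

Lemma lk_refl F : valid F -> size F = s -> lk F F.
Proof. by move=> v sz; apply: lk_perm. Qed.

Lemma perm_catc C p F : perm_eq (C ++ p :: F) (p :: C ++ F).
Proof. by rewrite (perm_catCA C [:: p] F). Qed.

Lemma lk_exchC p q C F : (size (C ++ F)).+1 = s -> valid (C ++ p :: F) ->
  valid (C ++ q :: F) -> lk (C ++ p :: F) (C ++ q :: F).
Proof.
move=> sz v1 v2.
have v1' : valid (p :: C ++ F) by rewrite -(valid_perm (perm_catc C p F)).
have v2' : valid (q :: C ++ F) by rewrite -(valid_perm (perm_catc C q F)).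
apply: (@lk_trans _ (p :: C ++ F)) => //.
  by apply: lk_perm => //; [rewrite size_cat addnS -size_cat|apply: perm_catc].
apply: (@lk_trans _ (q :: C ++ F)) => //; first exact: lk_exch.
by apply: lk_perm => //; rewrite perm_sym perm_catc.
Qed.

(** Normalisation: the pair of [F] containing [x] comes to the front with [x] as its first element.
    Reversing it is itself an exchange of one pair. *)
Lemma pull_pt C F x : valid (C ++ F) -> size (C ++ F) = s -> x \in pts F ->
  exists y F', [/\ valid (C ++ (x, y) :: F'), size F = (size F').+1,
     lk (C ++ F) (C ++ (x, y) :: F'), lk (C ++ (x, y) :: F') (C ++ F) &
     pts F =i pts ((x, y) :: F')].
Proof.
move=> v sz; rewrite mem_cat => h.
have [p pF hp] : exists2 p, p \in F & p.1 = x \/ p.2 = x.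
  by case/orP: h => /mapP[p pF ->]; exists p => //; [left|right].
pose F' := rem p F.
have pe : perm_eq F (p :: F') by apply: perm_to_rem.
have pe' : perm_eq (C ++ F) (C ++ p :: F') by rewrite perm_cat2l.
have v' : valid (C ++ p :: F') by rewrite -(valid_perm pe').
have sz' : size F = (size F').+1 by rewrite (perm_size pe).
have szC : (size (C ++ F')).+1 = s by rewrite -sz !size_cat sz' addnS.
have szp : size (C ++ p :: F') = s by rewrite -(perm_size pe').
have mp : pts F =i pts (p :: F') by apply: perm_mem; apply: perm_pts.
have l1 : lk (C ++ F) (C ++ p :: F') by apply: lk_perm.
have l2 : lk (C ++ p :: F') (C ++ F) by apply: lk_perm => //; rewrite perm_sym.
case: p hp => a b /= [] hx in pF F' pe pe' v' sz' szC szp mp l1 l2 *; subst x.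
  by exists b, F'.
have v2 : valid (C ++ (b, a) :: F').
  rewrite (valid_perm (perm_catc _ _ _)); move: v'; rewrite (valid_perm (perm_catc _ _ _)).
  rewrite /valid !matching_cons /= sparsef_swap => /andP[/and5P[h1 h2 h3 h4 /andP[h5 h6]] ->].
  by rewrite eq_sym h1 h2 h3 h4 h5 h6.
exists a, F'; split=> //.
- by apply: lk_trans l1 _ => //; apply: lk_exchC.
- by apply: lk_trans _ l2 => //; apply: lk_exchC.
- by move=> z; rewrite mp !mem_pts_cons /= orbCA.
Qed.

(** [C ++ F] fills [X] up to the bound, so inside [X] there are at least as many pairs of [F] as of
    [Q]. *)
Lemma pull_inside C F Q X : tight (C ++ F) X -> sparsef (C ++ Q) ->
  X != set0 -> 0 < cnt Q X ->
  exists2 p, p \in F & (u p.1 \in X) && (u p.2 \in X).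
Proof.
move=> /eqP t /sparsefP /(_ X) h X0 c0; have := h X0; rewrite -t /cnt !count_cat => h'.
have : has (fun p => (u p.1 \in X) && (u p.2 \in X)) F by rewrite has_count; move: c0 h'; rewrite /cnt; lia.
by case/hasP=> p; exists p.
Qed.

(** If [(x, y)] cannot just be added, some tight set contains both far ends. Dropping a pair [f]
    inside the smallest such set makes room: a set still blocking afterwards would contain the
    smallest one, hence [f], and be overfull with [f] put back. *)
Lemma enter_free_pair C F Q x y : valid (C ++ F) -> size (C ++ F) = s ->
  x \notin pts (C ++ F) -> y \notin pts (C ++ F) ->
  valid (C ++ (x, y) :: Q) -> size F = (size Q).+1 ->
  exists F', [/\ valid (C ++ (x, y) :: F'), size F' = size Q &
                 lk (C ++ F) (C ++ (x, y) :: F')].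
Proof.
move=> vF szF xF yF vQ szQ.
have sF : sparsef (C ++ F) by case/andP: vF.
have sQ : sparsef (C ++ (x, y) :: Q) by case/andP: vQ.
have mxy F' f : perm_eq F (f :: F') -> matching ((x, y) :: C ++ F').
  move=> pe; move: vQ; rewrite (valid_perm (perm_catc _ _ _)) /valid !matching_cons /=.
  move=> /andP[/and5P[-> -> -> _ _] _] /=.
  have pe' : perm_eq (C ++ F) (f :: C ++ F').
    by apply: perm_trans (perm_catc C f F'); rewrite perm_cat2l.
  move: vF xF yF; rewrite (valid_perm pe') /valid (perm_mem (perm_pts pe')) (perm_mem (perm_pts pe')).
  rewrite !mem_pts_cons !negb_or matching_cons => /andP[/and5P[_ _ _ _ /andP[_ ->]] _].
  by move=> /and3P[_ _ ->] /and3P[_ _ ->].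
suff [f fF sf] : exists2 f, f \in F & sparsef ((x, y) :: C ++ rem f F).
  have pe : perm_eq F (f :: rem f F) by apply: perm_to_rem.
  have pe' : perm_eq (C ++ F) (C ++ f :: rem f F) by rewrite perm_cat2l.
  have sz' : size F = (size (rem f F)).+1 by rewrite (perm_size pe).
  have v' : valid (C ++ (x, y) :: rem f F).
    by rewrite (valid_perm (perm_catc _ _ _)) /valid (mxy _ _ pe).
  exists (rem f F); split=> //; first by move: szQ; rewrite sz' => -[].
  have vf : valid (C ++ f :: rem f F) by rewrite -(valid_perm pe').
  apply: (@lk_trans _ (C ++ f :: rem f F)) => //.
  - by rewrite -(perm_size pe').
  - exact: lk_perm.
  - by apply: lk_exchC => //; rewrite -szF !size_cat sz' addnS.
have [sxy|nsxy] := boolP (sparsef ((x, y) :: C ++ F)).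
  case: F szQ sxy {vF szF xF yF sF mxy} => // f F _ sxy; exists f; rewrite ?inE ?eqxx //=.
  rewrite eqxx; apply/sparsefP => X X0; move/sparsefP: sxy => /(_ X X0).
  by rewrite !cnt_cons /cnt !count_cat /=; lia.
case: (min_tight (sparsef_add sF nsxy)) => X /= [tX xX yX m].
have X0 : X != set0 by apply/set0Pn; exists (u x).
have [|f fF fX] := pull_inside tX sQ X0; first by rewrite cnt_cons xX yX.
exists f => //; have pe : perm_eq (C ++ F) (f :: C ++ rem f F).
  by apply: perm_trans (perm_catc C f _); rewrite perm_cat2l perm_to_rem.
have eqc Y : cnt (C ++ F) Y = cnt (f :: C ++ rem f F) Y by rewrite /cnt (seq.permP pe).
have sf : sparsef (f :: C ++ rem f F).
  by apply/sparsefP => Y Y0; rewrite -eqc; move/sparsefP: sF; apply.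
apply/negPn/negP => /(sparsef_add (sparsef_cons sf))[Y [tY /= xY yY]].
have tY' : tight (C ++ F) Y.
  rewrite /tight; move/sparsefP: sF => /(_ Y); move/eqP: tY => <-.
  have Y0 : Y != set0 by apply/set0Pn; exists (u x).
  by move=> /(_ Y0) h; rewrite eqn_leq h eqc cnt_cons leq_add2l leq_addl.
have XY := tight_min_sub sF tX xX yX m tY' xY yY.
case/andP: fX => f1 f2.
by apply: (sparsef_over sf tY); apply: (subsetP XY).
Qed.

(* Here [X] is a minimal tight set around [x1] and [x2]; it contains the pair
   [(x4, x5)] but not [x3].  The pair [(x1, x2)] enters in four exchanges:
   23,45 - 13,45 - 13,24 - 35,24 - 35,12. *)
Lemma sparsef_walk G X x1 x2 x3 x4 x5 :
  sparsef [:: (x2, x3), (x4, x5) & G] -> tight ((x4, x5) :: G) X ->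
  u x1 \in X -> u x2 \in X -> u x4 \in X -> u x5 \in X ->
  (forall Y, tight ((x4, x5) :: G) Y -> u x1 \in Y -> u x2 \in Y -> #|X| <= #|Y|) ->
  sparsef [:: (x1, x3), (x2, x4) & G] ->
  [/\ sparsef [:: (x1, x3), (x4, x5) & G], sparsef [:: (x3, x5), (x2, x4) & G] &
      sparsef [:: (x3, x5), (x1, x2) & G]].
Proof.
move=> s0 tX h1 h2 h4 h5 m s2; have sG0 := sparsef_cons s0.
have sG := sparsef_cons sG0.
have same p : (u p.1 \in X) && (u p.2 \in X) -> tight (p :: G) X.
  by move=> hp; move: tX; rewrite /tight !cnt_cons hp h4 h5.
split.
- apply/negPn/negP => /(sparsef_add sG0)[Y [tY /= y1 y3]].
  have [t _] := tightUI sG0 tX tY h1 y1.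
  by apply: (sparsef_over s0 t); rewrite !inE /= ?h2 ?y3 ?orbT.
- have sG2 := sparsef_cons s2.
  apply/negPn/negP => /(sparsef_add sG2)[Y [tY /= y3 y5]].
  have tX2 : tight ((x2, x4) :: G) X by apply: same; rewrite h2 h4.
  have [t _] := tightUI sG2 tX2 tY h5 y5.
  by apply: (sparsef_over s2 t); rewrite !inE /= ?h1 ?y3 ?orbT.
have sG3 : sparsef ((x1, x2) :: G).
  apply/negPn/negP => /(sparsef_add sG)[Y [tY /= y1 y2]].
  have tY' : tight ((x4, x5) :: G) Y.
    move/sparsefP: sG0 => /(_ Y); move/eqP: tY; rewrite /tight => <-.
    have Y0 : Y != set0 by apply/set0Pn; exists (u x1).
    by move=> /(_ Y0) h; rewrite eqn_leq h cnt_cons leq_add2l leq_addl.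
  have XY := tight_min_sub sG0 tX h1 h2 m tY' y1 y2.
  by apply: (sparsef_over sG0 tY); apply: (subsetP XY).
apply/negPn/negP => /(sparsef_add sG3)[Y [tY /= y3 y5]].
have tX3 : tight ((x1, x2) :: G) X by apply: same; rewrite h1 h2.
have [t _] := tightUI sG3 tX3 tY h5 y5.
apply: (@sparsef_over (x2, x3) _ (X :|: Y) s0); rewrite ?inE /= ?h2 ?y3 ?orbT //.
by move: t; rewrite /tight !cnt_cons !inE /= h1 h2 h4 h5.
Qed.

Lemma perm_catc2 C p q F : perm_eq (C ++ [:: p, q & F]) [:: p, q & C ++ F].
Proof. by rewrite (perm_catCA C [:: p; q] F). Qed.

(** Replacing [(x2, x3)] by [(x1, x2)] fails only because of a tight set around [x1] and [x2]. The
    smallest one contains a pair of [F], which supplies the elements [x4] and [x5] for the detour of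
    [sparsef_walk]. *)
Lemma enter_half_free_pair C F Q x1 x2 x3 :
  valid (C ++ (x2, x3) :: F) -> size (C ++ (x2, x3) :: F) = s ->
  x1 \notin pts (C ++ (x2, x3) :: F) ->
  valid (C ++ (x1, x2) :: Q) ->
  exists F', [/\ valid (C ++ (x1, x2) :: F'), size F' = size F &
                 lk (C ++ (x2, x3) :: F) (C ++ (x1, x2) :: F')].
Proof.
move=> vF szF x1F vQ.
have permx p q G : perm_eq [:: p, q & G] [:: q, p & G] by rewrite (perm_catCA [:: p] [:: q] G).
have szCF : (size (C ++ F)).+1 = s by rewrite -szF !size_cat addnS.
have m0 : matching ((x1, x2) :: C ++ F).
  move: vQ x1F; rewrite (valid_perm (perm_catc _ _ _)) (perm_mem (perm_pts (perm_catc _ _ _))).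
  rewrite /valid !matching_cons mem_pts_cons /= !negb_or => /andP[/and5P[-> -> -> _ _] _].
  move=> /and3P[_ _ ->] /=; move: vF; rewrite (valid_perm (perm_catc _ _ _)).
  by rewrite /valid matching_cons /= => /andP[/and5P[_ _ _ -> /andP[_ ->]] _].
have x13 : x1 != x3.
  by move: x1F; rewrite (perm_mem (perm_pts (perm_catc _ _ _))) mem_pts_cons /= !negb_or => /and3P[].
have [s12|ns12] := boolP (sparsef ((x1, x2) :: C ++ F)).
  exists F; have v12 : valid (C ++ (x1, x2) :: F).
    by rewrite (valid_perm (perm_catc _ _ _)) /valid m0.
  by split=> //; apply: lk_exchC.
have vF' := vF; rewrite (valid_perm (perm_catc _ _ _)) in vF'.
have /andP[_ sF] := vF'; have sG := sparsef_cons sF.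
have /andP[_ sQ] := vQ.
case: (min_tight (sparsef_add sG ns12)) => X /= [tX x1X x2X m].
have X0 : X != set0 by apply/set0Pn; exists (u x1).
have [|f fF fX] := pull_inside tX sQ X0; first by rewrite cnt_cons /= x1X x2X.
pose F1 := rem f F.
have pe : perm_eq F (f :: F1) by apply: perm_to_rem.
have peC : perm_eq (C ++ F) (f :: C ++ F1).
  by apply: perm_trans (perm_catc C f _); rewrite perm_cat2l.
have [x4 [x5 [hf h4 h5 s24]]] : exists x4 x5, [/\ f = (x4, x5) \/ f = (x5, x4),
    u x4 \in X, u x5 \in X & sparsef [:: (x1, x3), (x2, x4) & C ++ F1]].
  have s13 : sparsef [:: (x1, x3), f & C ++ F1].
    have eqc Y : cnt (C ++ F) Y = cnt (f :: C ++ F1) Y by rewrite /cnt (seq.permP peC).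
    suff : sparsef ((x1, x3) :: C ++ F).
      move=> /sparsefP h; apply/sparsefP => Y /h.
      by rewrite [cnt (_ :: C ++ F) _]cnt_cons [cnt [:: _, _ & _] _]cnt_cons eqc.
    (* A tight set [Y] around [x1] and [x3] would unite with [X] into one around [x2] and [x3],
       where the pair [(x2, x3)] would not fit. *)
    apply/negPn/negP => /(sparsef_add sG)[Y [tY /= y1 y3]].
    have [t _] := tightUI sG tX tY x1X y1.
    by apply: (sparsef_over sF t); rewrite !inE /= ?x2X ?y3 ?orbT.
  have tr p q G : sparsef [:: p, q & G] -> sparsef [:: q, p & G].
    by rewrite (sparsef_perm (permx _ _ _)).
  move: fX s13 => /andP[aX bX] /tr; rewrite {1}(surjective_pairing f) => s13.
  (* One end of [f] can be paired with [x2]; that end is named [x4]. *)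
  case/orP: (sparsef_alt x2 s13) => h; [exists f.1, f.2|exists f.2, f.1]; split=> //.
  - by left; apply: surjective_pairing.
  - by apply: tr; rewrite sparsef_swap.
  - by right; apply: surjective_pairing.
  - by apply: tr; rewrite sparsef_swap.
have eqc Y : cnt (C ++ F) Y = cnt ((x4, x5) :: C ++ F1) Y.
  by rewrite /cnt (seq.permP peC) /=; case: hf => -> //=; rewrite andbC.
have s0 : sparsef [:: (x2, x3), (x4, x5) & C ++ F1].
  move/sparsefP: sF => h; apply/sparsefP => Y /h.
  by rewrite [cnt (_ :: C ++ F) _]cnt_cons [cnt [:: _, _ & _] _]cnt_cons eqc.
have tX' : tight ((x4, x5) :: C ++ F1) X by rewrite /tight -eqc.
have m' Y : tight ((x4, x5) :: C ++ F1) Y -> u x1 \in Y -> u x2 \in Y -> #|X| <= #|Y|.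
  by rewrite /tight -eqc; apply: m.
have [s1 s3 s4] := sparsef_walk s0 tX' x1X x2X h4 h5 m' s24.
have mm : matching [:: (x1, x2), (x4, x5) & C ++ F1].
  move: m0; rewrite !matching_cons /= => /and5P[-> -> -> h6 /andP[h7 h8]].
  move: h6 h7 h8; rewrite (matching_perm peC) matching_cons.
  rewrite !(perm_mem (perm_pts peC)) !mem_pts_cons.
  case: hf => -> /=; rewrite !negb_or; first by move=> -> -> ->.
  move=> /and3P[-> -> ->] /and3P[-> -> ->] /and5P[h9 -> -> -> ->].
  by rewrite eq_sym h9.
have n31 : x3 != x1 by rewrite eq_sym.
have [x3t n32 n34 n35 n3G] :
    [/\ x3 \in tk, x3 != x2, x3 != x4, x3 != x5 & x3 \notin pts (C ++ F1)].
  move: vF'; rewrite /valid matching_cons /= => /andP[/and5P[h9 _ -> _ /andP[h10 _]] _].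
  move: h10; rewrite (perm_mem (perm_pts peC)) mem_pts_cons (eq_sym x3 x2) h9.
  by case: hf => -> /=; rewrite !negb_or => /and3P[-> -> ->].
have allv : [/\ valid [:: (x2, x3), (x4, x5) & C ++ F1],
    valid [:: (x1, x3), (x4, x5) & C ++ F1], valid [:: (x1, x3), (x2, x4) & C ++ F1],
    valid [:: (x3, x5), (x2, x4) & C ++ F1] & valid [:: (x3, x5), (x1, x2) & C ++ F1]].
  rewrite /valid s0 s1 s24 s3 s4 !andbT.
  move: mm; rewrite !matching_cons !mem_pts_cons /= !negb_or -!andbA.
  case/and5P=> n12 x1t x2t n14 /and5P[n15 n1G n24 n25 /and5P[n2G n45 x4t x5t /and3P[n4G n5G ->]]].
  have sy (a b : D) : a != b -> b != a by rewrite eq_sym.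
  rewrite x1t x2t x3t x4t x5t n1G n2G n3G n4G n5G ?n12 ?n14 ?n15 ?n24 ?n25 ?n45 ?n31 ?n32 ?n34 ?n35.
  by rewrite ?(sy _ _ n31) ?(sy _ _ n32) ?(sy _ _ n45) ?(sy _ _ n25) ?(sy _ _ n15)
    ?(sy _ _ n14) ?(sy _ _ n24) ?(sy _ _ n12) ?(sy _ _ n34) ?(sy _ _ n35).
case: allv => v0 v1 v2 v3 v4.
have szF1 : size F = (size F1).+1 by rewrite (perm_size pe).
have sz2 : (size (C ++ F1)).+2 = s by rewrite -szCF !size_cat szF1 addnS.
have lx p q r : valid [:: p, q & C ++ F1] -> valid [:: p, r & C ++ F1] ->
    lk [:: p, q & C ++ F1] [:: p, r & C ++ F1].
  by move=> vq vr; apply: (@lk_exchC q r [:: p] (C ++ F1)).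
have v0' : valid [:: (x4, x5), (x2, x3) & C ++ F1] by rewrite (valid_perm (permx _ _ _)).
exists ((x3, x5) :: F1); split => //.
  rewrite (valid_perm (perm_catc2 _ _ _ _)) (valid_perm (permx _ _ _)) //.
have vf : valid [:: (x2, x3), f & C ++ F1].
  by rewrite -(valid_perm (_ : perm_eq ((x2, x3) :: C ++ F) _)) // perm_cons.
apply: (@lk_trans _ [:: (x2, x3), f & C ++ F1]) => //.
  apply: lk_perm => //; apply: perm_trans (perm_catc _ _ _) _.
  by rewrite perm_cons.
apply: (@lk_trans _ [:: (x2, x3), (x4, x5) & C ++ F1]) => //; first exact: lx.
apply: (@lk_trans _ [:: (x1, x3), (x4, x5) & C ++ F1]) => //; first by apply: lk_exch.
apply: (@lk_trans _ [:: (x1, x3), (x2, x4) & C ++ F1]) => //; first exact: lx.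
apply: (@lk_trans _ [:: (x3, x5), (x2, x4) & C ++ F1]) => //; first by apply: lk_exch.
apply: (@lk_trans _ [:: (x3, x5), (x1, x2) & C ++ F1]) => //; first exact: lx.
apply: lk_perm => //; rewrite perm_sym; apply: perm_trans (perm_catc2 _ _ _ _) _.
exact: permx.
Qed.

Lemma matching_size C F : size (C ++ F) = s -> exists2 x, x \in tk & x \notin pts (C ++ F).
Proof.
move=> sz; have [|x xt xF] := @subsetPn _ (mem tk) (mem (pts (C ++ F))) _; last by exists x.
apply/negP => /subset_leq_card h; have := card_size (pts (C ++ F)).
by rewrite size_pts sz => h'; have := leq_trans tk_big (leq_trans h h'); rewrite ltnn.
Qed.

(** Induction on the part [F] outside the common pairs [C]. If a point of [Q] is unpaired, its pair
    can be brought into the common part. Otherwise [F] and [Q] cover the same points, and an element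
    outside the pairing replaces [a] or [b] in a pair [(a, b)] of [F], which frees a point of
    [Q]. *)
Theorem matchings_linked C F Q : valid (C ++ F) -> valid (C ++ Q) ->
  size (C ++ F) = s -> size F = size Q -> lk (C ++ F) (C ++ Q).
Proof.
have [n] := ubnP (size F); elim: n C F Q => // n IH C F Q leF vF vQ szF szFQ.
have szQ : size (C ++ Q) = s by rewrite size_cat -szFQ -size_cat.
have half G x : valid (C ++ G) -> size G = size F -> x \in pts Q ->
    x \notin pts (C ++ G) -> lk (C ++ G) (C ++ Q).
  move=> vG szG xQ xG; have szCG : size (C ++ G) = s by rewrite size_cat szG -size_cat.
  have [y [Q' [vQ' szQ' _ lQ eQ]]] := pull_pt vQ szQ xQ.
  suff [F' [vF' szF' lF]] : exists F', [/\ valid (C ++ (x, y) :: F'), size F' = size Q' &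
                 lk (C ++ G) (C ++ (x, y) :: F')].
    have szC : size ((C ++ [:: (x, y)]) ++ F') = s.
      by rewrite -catA /= -szQ !size_cat /= szF' szQ'.
    apply: (lk_trans vF') lF _; first by rewrite -szC -catA.
    apply: lk_trans lQ => //; first by rewrite -szQ !size_cat /= szQ'.
    have := IH (C ++ [:: (x, y)]) F' Q'; rewrite -!catA /=; apply=> //; first by move: leF; rewrite szFQ szQ' szF'.
    by rewrite -szC -catA.
  have [yG|yG] := boolP (y \in pts (C ++ G)); last by apply: enter_free_pair; rewrite ?szG ?szFQ.
  have yG' : y \in pts G.
    move: yG; rewrite mem_pts_cat => /orP[yC|//]; move: vQ'; rewrite (valid_perm (perm_catc _ _ _)).
    by rewrite /valid matching_cons /= !mem_pts_cat yC /= !andbF.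
  have [z [G' [vG' szG' lG _ eG]]] := pull_pt vG szCG yG'.
  have szCG' : size (C ++ (y, z) :: G') = s by rewrite -szCG !size_cat szG'.
  have xG' : x \notin pts (C ++ (y, z) :: G') by move: xG; rewrite !mem_pts_cat eG.
  have [F' [vF' szF' lF]] := enter_half_free_pair vG' szCG' xG' vQ'.
  exists F'; split=> //; last exact: lk_trans lG lF.
  by apply: succn_inj; rewrite szF' -szG' szG szFQ szQ'.
case: F szF szFQ leF vF half => [|[a b] F] szF szFQ leF vF half.
  by case: Q szFQ {vQ szQ half} => // _; apply: lk_refl.
have [sub|/allPn[x xQ xF]] := boolP (all (mem (pts (C ++ (a, b) :: F))) (pts Q)); last first.
  exact: half xQ xF.
have uQ : uniq (pts Q).
  move: vQ => /andP[/andP[h _] _]; move: h.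
  by rewrite (perm_uniq (perm_pts_cat _ _)) cat_uniq => /and3P[].
have subF : {subset pts Q <= pts ((a, b) :: F)}.
  move=> x xQ; move/allP: sub => /(_ x xQ) /=; rewrite mem_pts_cat => /orP[xC|//].
  move: vQ => /andP[/andP[h _] _]; move: h.
  rewrite (perm_uniq (perm_pts_cat _ _)) cat_uniq => /and3P[_ /hasPn/(_ x xQ)].
  by rewrite /= xC.
have eQ : pts Q =i pts ((a, b) :: F).
  by have [] := uniq_min_size uQ subF; rewrite // !size_pts szFQ.
have [x xt xF] := matching_size szF.
have vF' := vF; rewrite (valid_perm (perm_catc _ _ _)) in vF'.
have /andP[mF sF] := vF'.
move: xF; rewrite (perm_mem (perm_pts (perm_catc _ _ _))) mem_pts_cons /= !negb_or => /and3P[xa xb xF].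
move: (mF); rewrite matching_cons /= => /and5P[ab ta tb aF /andP[bF mCF]].
have szF' : (size (C ++ F)).+1 = s by rewrite -szF !size_cat addnS.
case/orP: (sparsef_alt x sF) => hs.
  have vx : valid (C ++ (a, x) :: F).
    rewrite (valid_perm (perm_catc _ _ _)) /valid hs matching_cons /= ta xt aF xF mCF.
    by rewrite eq_sym xa.
  apply: (@lk_trans _ (C ++ (a, x) :: F)) => //.
  - by rewrite -szF !size_cat.
  - exact: lk_exchC.
  apply: (half _ b) => //; first by rewrite eQ mem_pts_cons /= eqxx orbT.
  rewrite (perm_mem (perm_pts (perm_catc _ _ _))) mem_pts_cons /= !negb_or bF.
  by rewrite eq_sym ab eq_sym xb.
have vx : valid (C ++ (b, x) :: F).
  rewrite (valid_perm (perm_catc _ _ _)) /valid hs matching_cons /= tb xt bF xF mCF.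
  by rewrite eq_sym xb.
apply: (@lk_trans _ (C ++ (b, x) :: F)) => //.
- by rewrite -szF !size_cat.
- exact: lk_exchC.
apply: (half _ a) => //; first by rewrite eQ mem_pts_cons /= eqxx.
rewrite (perm_mem (perm_pts (perm_catc _ _ _))) mem_pts_cons /= !negb_or aF.
by rewrite ab eq_sym xa.
Qed.

End Matchings.

(** * Reconfiguration of decompositions *)

Section Reconfiguration.
Variables (V E : finType) (ends : E -> V * V) (k : nat).
Implicit Types (S : {set E}) (c : E -> 'I_k) (i j l : 'I_k).

(** The shared class must have the same colour on both sides. This is stronger than sharing a member
    of the two families, so connectivity of colourings implies that of families. *)
Definition step S c c' : Prop :=
  [/\ dec ends S c, dec ends S c' & exists i, cls S c i = cls S c' i].

Inductive conn S c : (E -> 'I_k) -> Prop :=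
| conn_refl : conn S c c
| conn_step c' c'' : step S c c' -> conn S c' c'' -> conn S c c''.

Lemma conn1 S c c' : step S c c' -> conn S c c'.
Proof. by move=> h; apply: conn_step h _; apply: conn_refl. Qed.

Lemma conn_trans S c c' c'' : conn S c c' -> conn S c' c'' -> conn S c c''.
Proof. by elim=> // {c c'} c c1 c2 st _ IH /IH; apply: conn_step. Qed.

Lemma conn_sym S c c' : conn S c c' -> conn S c' c.
Proof.
elim=> [{}c|{c c'} c c1 c2 [d1 d2 [i e]] _ IH]; first exact: conn_refl.
by apply: conn_trans IH _; apply: conn1; split=> //; exists i.
Qed.

Lemma eq_cls S c c' i : {in S, c =1 c'} -> cls S c i = cls S c' i.
Proof. by move=> h; apply/setP => e; rewrite !inE; case: (boolP (e \in S)) => // /h ->. Qed.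

Lemma cls_sub S c i : cls S c i \subset S.
Proof. by apply/subsetP => e; rewrite inE => /andP[]. Qed.

Lemma third_class i l : 2 < k -> exists j, (j != i) && (j != l).
Proof.
move=> k3; have : #|[set i; l]| < #|'I_k| by rewrite card_ord; apply: leq_trans k3; rewrite cards2; case: (_ != _).
rewrite -cardsT => h; have : ~~ ([set: 'I_k] \subset [set i; l]).
  by apply/negP => /subset_leq_card; rewrite leqNgt h.
by case/subsetPn => j _; rewrite !inE negb_or => h'; exists j.
Qed.

Lemma cls_swap S c y z i l : y \in S -> z \in S -> c y = i -> c z = l -> i != l ->
  forall j, cls S [eta c with y |-> l, z |-> i] j =
    if j == l then y |: (cls S c l :\ z)
    else if j == i then z |: (cls S c i :\ y) else cls S c j.
Proof.
move=> yS zS cy cz nil j.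
have nli : (l == i) = false by rewrite eq_sym (negbTE nil).
have nzy : (z == y) = false by apply/negbTE; apply: contraNneq nil => e; rewrite -cy -cz e.
have nyz : (y == z) = false by rewrite eq_sym nzy.
apply/setP => e; have [->|njl] := eqVneq j l.
  rewrite !inE /=; have [->|ney] := eqVneq e y; first by rewrite yS eqxx.
  by have [->|//] := eqVneq e z; rewrite (negbTE nil) andbF.
have nlj : (l == j) = false by rewrite eq_sym (negbTE njl).
have [->|nji] := eqVneq j i; rewrite !inE /=.
  have [->|ney] := eqVneq e y; first by rewrite nli nyz andbF.
  by have [->|//] := eqVneq e z; rewrite zS eqxx.
have nij : (i == j) = false by rewrite eq_sym (negbTE nji).
have [->|ney] := eqVneq e y; first by rewrite nlj cy nij !andbF.
by have [->|//] := eqVneq e z; rewrite cz nlj nij !andbF.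
Qed.

Lemma swap_step S c y z i l : 2 < k -> y \in S -> z \in S -> c y = i -> c z = l -> i != l ->
  dec ends S c -> forest ends (y |: (cls S c l :\ z)) ->
  forest ends (z |: (cls S c i :\ y)) ->
  step S c [eta c with y |-> l, z |-> i].
Proof.
move=> k3 yS zS cy cz nil dc f1 f2; split=> //.
  by move=> j; rewrite (cls_swap yS zS cy cz nil); case: eqP => // _; case: eqP.
have [j /andP[ji jl]] := third_class i l k3; exists j.
by rewrite (cls_swap yS zS cy cz nil) (negbTE ji) (negbTE jl).
Qed.

(** Every class is a forest with at most [|X| - 1] edges and the total is [k] times that, so each
    class attains the bound and spans [X]. *)
Lemma card_cls_max S c (X : {set V}) : 0 < #|X| ->
  (forall e, e \in S -> ((ends e).1 \in X) && ((ends e).2 \in X)) ->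
  #|S| = k * #|X|.-1 -> dec ends S c ->
  (forall i, #|cls S c i| = #|X|.-1) /\
  (forall i x y, x \in X -> y \in X -> con ends (cls S c i) x y).
Proof.
move=> X0 SX cS dc; have iX i : inn ends (cls S c i) X = cls S c i.
  by apply/setP => e; rewrite !inE; case: (boolP (e \in S)) => //= /SX ->; rewrite andbT.
have le i : #|cls S c i| <= #|X|.-1.
  by have := forest_card (dc i) (_ : X != set0); rewrite iX -card_gt0 X0 => /(_ isT); lia.
have eqc i : #|cls S c i| = #|X|.-1.
  apply/eqP; rewrite eqn_leq le /= leqNgt; apply/negP => lt.
  have : \sum_j #|cls S c j| < \sum_(j < k) #|X|.-1.
    rewrite (bigD1 i) //= [X in _ < X](bigD1 i) //= -addSn; apply: leq_add => //.
    exact: leq_sum.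
  by rewrite -card_cls sum_nat_const card_ord cS ltnn.
split=> // i x y xX yX.
by rewrite -iX; apply: forest_card_con => //; rewrite iX eqc prednK.
Qed.

Lemma inn_super (A : {set E}) (X Y : {set V}) :
  #|inn ends A X| + #|inn ends A Y| <= #|inn ends A (X :|: Y)| + #|inn ends A (X :&: Y)|.
Proof.
rewrite -cardsUI; apply: leq_add; apply: subset_leq_card; apply/subsetP => e; rewrite !inE.
  by case/orP => /and3P[-> -> ->]; rewrite ?orbT.
by case/andP => /and3P[-> -> ->] /and3P[_ -> ->].
Qed.

End Reconfiguration.

Lemma finset_bij (I T : finType) (A : {set I}) (B : {set T}) (t0 : T) : #|A| = #|B| ->
  exists r : I -> T, [/\ {in A, forall x, r x \in B}, {in A &, injective r} &
    forall y, y \in B -> exists2 x, x \in A & r x = y].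
Proof.
rewrite !cardE => eAB; exists (fun x => nth t0 (enum B) (index x (enum A))).
have ind x : x \in A -> index x (enum A) < size (enum B).
  by move=> xA; rewrite -eAB index_mem mem_enum.
split.
- by move=> x xA; rewrite -mem_enum mem_nth ?ind.
- move=> x y xA yA /eqP; rewrite nth_uniq ?enum_uniq ?ind // => /eqP e.
  by rewrite -[x](nth_index x (s := enum A)) ?mem_enum // e nth_index ?mem_enum.
- move=> y yB; have iy : index y (enum B) < size (enum A) by rewrite eAB index_mem mem_enum.
  case: (enum A) iy (mem_enum A) (enum_uniq A) => // x0 s iy me us.
  exists (nth x0 (x0 :: s) (index y (enum B))); first by rewrite -me mem_nth.
  by rewrite index_uniq // nth_index ?mem_enum.
Qed.

(** * Removing a vertex of small degree *)

Section Star.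
Variables (V L : finType) (k : nat).
(** An edge is a label together with its two ends, so that edges created by splitting off live in
    the same type. The vertex type stays fixed as well; [W] is the current vertex set. *)
Let U : finType := (L * (V * V))%type.
Let ends : U -> V * V := snd.
Variables (W : {set V}) (S : {set U}) (v : V) (c0 : U -> 'I_k).
Hypothesis k3 : 2 < k.
Hypothesis vW : v \in W.
Hypothesis W2 : 1 < #|W|.
Hypothesis SW : forall e : U, e \in S -> ((ends e).1 \in W) && ((ends e).2 \in W).
Hypothesis labS : {in S &, injective (fun e : U => e.1)}.
Hypothesis cardS : #|S| = k * #|W|.-1.
Hypothesis dec0 : dec ends S c0.
Implicit Types (c : U -> 'I_k) (A B : {set U}) (e f x y z : U) (i j l : 'I_k).

Definition star : {set U} := [set e in S | (e.2.1 == v) || (e.2.2 == v)].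
Definition rest : {set U} := S :\: star.
Definition tip (e : U) : V := if e.2.1 == v then e.2.2 else e.2.1.

Hypothesis deg_lt : #|star| < 2 * k.

Lemma star_S e : e \in star -> e \in S. Proof. by rewrite inE => /andP[]. Qed.
Lemma rest_S e : e \in rest -> e \in S. Proof. by rewrite inE => /andP[]. Qed.

Lemma no_loop e : e \in S -> e.2.1 != e.2.2.
Proof.
move=> eS; have eC : e \in cls S c0 (c0 e) by rewrite inE eS eqxx.
by have := dec0 eC; apply: contraNneq => ->; apply: con_refl.
Qed.

Lemma tipP e : e \in star ->
  [/\ ends e = (v, tip e) \/ ends e = (tip e, v), tip e != v & tip e \in W :\ v].
Proof.
rewrite inE => /andP[eS h]; have := no_loop eS; have := SW eS.
rewrite /tip /ends !inE; case: e eS h => lab [a b] /= eS h /andP[aW bW].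
have [->|nav] := eqVneq a v; first by rewrite eq_sym => nb; rewrite nb bW; split=> //; left.
by move: h; rewrite (negbTE nav) /= => /eqP bv _; split=> //; right; rewrite bv.
Qed.

Lemma rest_ends e : e \in rest -> [/\ e.2.1 != v, e.2.2 != v, e.2.1 \in W :\ v & e.2.2 \in W :\ v].
Proof.
rewrite !inE negb_and => /andP[h eS]; move: h; rewrite eS /= negb_or => /andP[-> ->].
by have /andP[-> ->] := SW eS.
Qed.

Lemma restP e : e \in S -> e \notin star -> e \in rest.
Proof. by rewrite in_setD => -> ->. Qed.

Lemma rest_star e : e \in rest -> e \notin star.
Proof. by rewrite in_setD => /andP[]. Qed.

Lemma con_tip A e : e \in star -> e \in A -> con ends A v (tip e).
Proof.
move=> es eA; have [[h|h] _ _] := tipP es; have := con_edge ends eA; rewrite h //=.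
by rewrite con_sym.
Qed.

Lemma con_ends_tip A e : e \in star ->
  con ends A (ends e).1 (ends e).2 = con ends A v (tip e).
Proof. by move=> es; have [[->|->] _ _] := tipP es; rewrite //= con_sym. Qed.

Definition avoids A := forall e, e \in A -> (e.2.1 != v) && (e.2.2 != v).

Lemma avoids_con A (w : V) : avoids A -> con ends A v w -> w = v.
Proof.
move=> av h; apply/eqP; change (pred1 v w).
by rewrite -(con_closed (C := pred1 v) _ h) /= ?eqxx // => e /av /andP[/negbTE -> /negbTE ->].
Qed.

Lemma avoids_rest A : A \subset rest -> avoids A.
Proof. by move=> /subsetP h e /h /rest_ends[-> ->]. Qed.

(** [v] is isolated in [A], so the new edge hangs it on as a leaf. *)
Lemma leaf_forest A e : avoids A -> forest ends A -> e \in star -> forest ends (e |: A).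
Proof.
move=> av fA es; apply: forest_setU1 => //; rewrite con_ends_tip //.
by apply/negP => /(avoids_con av) h; have [_] := tipP es; rewrite h eqxx.
Qed.

Lemma cls_split c i : cls S c i = cls rest c i :|: cls star c i.
Proof.
apply/setP => e; rewrite !inE; case: (e \in S) => //=.
by case: ((e.2.1 == v) || (e.2.2 == v)); rewrite /= ?orbF.
Qed.

Lemma W0 : 0 < #|W|. Proof. by apply: ltn_trans W2. Qed.

Lemma span c : dec ends S c -> (forall i, #|cls S c i| = #|W|.-1) /\
  (forall i (x y : V), x \in W -> y \in W -> con ends (cls S c i) x y).
Proof. by move=> dc; apply: card_cls_max => //; apply: W0. Qed.

Lemma cardW' : #|W :\ v| = #|W|.-1.
Proof. by rewrite (cardsD1 v W) vW. Qed.

Lemma cls_card_split c i : #|cls S c i| = #|cls rest c i| + #|cls star c i|.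
Proof.
rewrite cls_split cardsU (_ : _ :&: _ = set0) ?cards0 ?subn0 //.
by apply/setP => e; rewrite !inE; case: (e \in S) => //=; case: (_ || _); rewrite /= ?andbF.
Qed.

(** A class has [|W| - 1] edges, one more than a forest on [W :\ v] can have. *)
Lemma star_pos c i : dec ends S c -> 0 < #|cls star c i|.
Proof.
move=> dc; have [h _] := span dc; have := h i; rewrite cls_card_split.
have W'0 : W :\ v != set0 by rewrite -card_gt0 cardW'; move: W2; case: #|W| => [|[]].
have fr : forest ends (cls rest c i).
  by apply: forest_sub (dc i); rewrite cls_split subsetUl.
have := forest_card fr W'0; rewrite cardW'.
have -> : inn ends (cls rest c i) (W :\ v) = cls rest c i.
  apply/setP => e; rewrite inE andb_idr // => /(subsetP (cls_sub _ _ _)) /rest_ends[_ _ h1 h2].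
  by rewrite h1 h2.
by case: #|cls star c i| => // h1; rewrite addn0 => h2; rewrite h2 ltnn in h1.
Qed.

Lemma star_wild c : dec ends S c -> exists i, #|cls star c i| = 1.
Proof.
move=> dc; have [/existsP[i /eqP h]|/existsPn h] := boolP [exists i, #|cls star c i| == 1]; first by exists i.
have : \sum_(i < k) 2 <= #|star|.
  rewrite (card_cls star c); apply: leq_sum => i _.
  by move: (h i) (star_pos i dc); case: #|_| => [|[]].
by rewrite sum_nat_const card_ord mulnC leqNgt deg_lt.
Qed.

(** * Decompositions that agree off [v] *)

Lemma same_rest_star c c' i : dec ends S c -> dec ends S c' -> {in rest, c =1 c'} ->
  #|cls star c i| = #|cls star c' i|.
Proof.
move=> dc dc' h; have [h1 _] := span dc; have [h2 _] := span dc'.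
by move: (h1 i); rewrite -(h2 i) !cls_card_split (eq_cls _ h) => /addnI.
Qed.

(** The class [i] in which [v] is a leaf serves as a buffer. Its edge [y] at [v] receives its final
    colour [l]; the cycle closed in class [l] contains an edge [z] at [v] whose final colour is not
    [l], and [z] becomes the leaf edge. The number of wrongly coloured edges falls. *)
Lemma same_rest_conn c c' : dec ends S c -> dec ends S c' -> {in rest, c =1 c'} ->
  conn ends S c c'.
Proof.
have [n] := ubnP #|[set e in star | c e != c' e]|; elim: n c => // n IH c le dc dc' hr.
have [i wi] := star_wild dc; have wi' := wi; rewrite (same_rest_star i dc dc' hr) in wi'.
case/eqP/cards1P: wi => y ey; case/eqP/cards1P: wi' => x ex.
have [exy|nxy] := eqVneq x y.
  apply: conn1; split=> //; exists i.
  by rewrite !cls_split ey ex exy (eq_cls _ hr).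
have : y \in cls star c i by rewrite ey set11.
rewrite inE => /andP[ys /eqP cy]; pose l := c' y.
have nil : i != l.
  apply: contraNneq nxy => e; have : y \in cls star c' i by rewrite inE ys e eqxx.
  by rewrite ex inE eq_sym.
have [_ sp] := span dc; have [_ _ tyW] := tipP ys.
have tyW' : tip y \in W by move: tyW; rewrite inE => /andP[].
pose D := [set z in star | c' z != l].
(* Without [D], class [l] of [c] lies in class [l] of [c'] minus [y], which separates the ends of
   [y]. *)
have nD : ~~ con ends (cls S c l :\: D) v (tip y).
  have yT' : y \in cls S c' l by rewrite inE star_S //= eqxx.
  have := dc' l y yT'; rewrite con_ends_tip //; apply: contra; apply: con_sub.
  apply/subsetP => z; rewrite in_setD [z \in cls _ _ _]inE [z \in D]inE negb_and negbK.
  rewrite !in_setD1 [z \in cls _ _ _]inE => /andP[h /andP[zS /eqP cz]].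
  rewrite zS /=; apply/andP; split; first by apply: contraNneq nil => e; rewrite -cy -cz e.
  by case/orP: h => // zs; rewrite -hr ?cz ?restP.
have [z [zD zT nz]] := essential_edge (dc l) (sp l v (tip y) vW tyW') nD.
move: zD zT; rewrite !inE => /andP[/andP[zS zst] nz'] /andP[_ /eqP cz].
have zs : z \in star by rewrite inE zS.
have st := @swap_step _ _ ends k S c y z i l k3 (star_S ys) zS cy cz nil dc.
have {}st : step ends S c [eta c with y |-> l, z |-> i].
  apply: st.
    apply: forest_setU1; last by rewrite con_ends_tip.
    by apply: forest_sub (dc l); apply: subD1set.
  have -> : cls S c i :\ y = cls rest c i.
    rewrite cls_split ey setDUl setDv setU0; apply/setDidPl; rewrite disjoint_sym disjoints1.
    by rewrite inE negb_and; apply/orP; left; rewrite inE ys.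
  apply: leaf_forest => //.
    by apply: avoids_rest; apply: cls_sub.
  by apply: forest_sub (dc i); rewrite cls_split subsetUl.
apply: conn_step (st) _; apply: IH => //; last 2 first.
- by case: st.
- move=> e er /=; have nes := rest_star er.
  have /negbTE-> : e != y by apply: contraNneq nes => ->.
  have /negbTE-> : e != z by apply: contraNneq nes => ->.
  exact: hr.
rewrite ltnS in le; apply: leq_trans le; apply: proper_card; apply/properP; split.
  apply/subsetP => e; rewrite !inE /=; have [->|ney] := eqVneq e y; first by rewrite eqxx andbF.
  by have [->|//] := eqVneq e z; rewrite zS zst cz (eq_sym l) nz'.
exists y; first by rewrite inE ys cy.
by rewrite inE /= eqxx -/l eqxx andbF.
Qed.

(** The path from [v] to [w] uses only one edge at [v], so it avoids [y] or [g]. *)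
Lemma two_star A y g (w : V) : forest ends A -> y \in star -> g \in star -> y \in A -> g \in A ->
  y != g -> con ends A v w -> con ends (A :\ y) v w \/ con ends (A :\ g) v w.
Proof.
move=> fA ys gs yA gA nyg cA.
have [|ny] := boolP (con ends (A :\ y) v w); first by left.
have [|ng] := boolP (con ends (A :\ g) v w); first by right.
exfalso.
have fy := fA y yA; rewrite con_ends_tip // in fy.
have h1 : con ends (A :\ y) (tip y) w.
  move: cA; rewrite -{1}(setD1K yA) => /con_setU1[h|[h1 h2]|[h1 h2]].
  - by rewrite h in ny.
  - by case: (tipP ys) => -[] e _ _; rewrite e in h1 h2 => //; rewrite h1 in fy.
  - by case: (tipP ys) => -[] e _ _; rewrite e in h1 h2 => //; rewrite h1 in fy.
have gAy : g \in A :\ y by rewrite in_setD1 eq_sym nyg.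
have yAg : y \in A :\ g by rewrite in_setD1 nyg.
have s1 : A :\ y :\ g \subset A :\ g by apply: setSD; apply: subD1set.
have s2 : A :\ y :\ g \subset A :\ y by apply: subD1set.
have contra1 : con ends (A :\ y :\ g) (tip y) w -> False.
  by move=> h; case/negP: ng; apply: con_trans (con_tip ys yAg) (con_sub s1 h).
have contra2 : con ends (A :\ y :\ g) (tip y) v -> False.
  by move=> h; case/negP: fy; rewrite con_sym; apply: con_sub h.
have contra3 : con ends (A :\ y :\ g) v w -> False.
  by move=> h; case/negP: ng; apply: con_sub h.
move: h1; rewrite -{1}(setD1K gAy) => /con_setU1[h|[h1 h2]|[h1 h2]]; first exact: contra1.
  by case: (tipP gs) => -[] e _ _; rewrite e /= in h1 h2; [apply: contra2|apply: contra3].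
by case: (tipP gs) => -[] e _ _; rewrite e /= in h1 h2; [apply: contra3|apply: contra2].
Qed.

(** An edge [y] at [v] moves from a class [a] with at least three edges at [v] to a class [b] with
    only one, and an edge [g] off [v] moves back. Class [a] keeps at least two, so the number of
    classes with [v] as a leaf drops. *)
Lemma balance c : dec ends S c -> exists c1, [/\ conn ends S c c1, dec ends S c1 &
  forall i, #|cls star c1 i| <= 2].
Proof.
have [n] := ubnP #|[set i | #|cls star c i| == 1]|; elim: n c => // n IH c le dc.
have [/forallP h|] := boolP [forall i, #|cls star c i| <= 2].
  by exists c; split=> //; apply: conn_refl.
rewrite negb_forall => /existsP[a]; rewrite -ltnNge => ha.
have [b hb] := star_wild dc; have nab : a != b by apply: contraTneq ha => ->; rewrite hb.
case/eqP/cards1P: (hb) => x ex.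
have : x \in cls star c b by rewrite ex set11.
rewrite inE => /andP[xs /eqP cx].
have [_ sp] := span dc; pose A := cls S c a; pose B := cls S c b.
have inW e : e \in star -> tip e \in W.
  by move=> /tipP[_ _]; rewrite inE => /andP[].
(* With this choice of [y], class [a] without [y] still joins [v] to the far end of the leaf edge
   [x] of class [b]. So [x] does not cross the cut [C] around the far end of [y], and the edge [g]
   of class [b] found in that cut is off [v]. *)
have [y [ys cy hy]] : exists y, [/\ y \in star, c y = a & con ends (A :\ y) v (tip x)].
  have /card_gt1P[y [g [yA gA nyg]]] : 1 < #|cls star c a| by apply: ltnW.
  move: yA gA; rewrite ![_ \in cls _ _ _]inE => /andP[ys /eqP cy] /andP[gs /eqP cg].
  have [] := @two_star A y g (tip x) (dc a) ys gs _ _ nyg (sp a v (tip x) vW (inW _ xs)).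
  - by rewrite inE star_S // cy eqxx.
  - by rewrite inE star_S // cg eqxx.
  - by exists y.
  - by exists g.
have yA : y \in A by rewrite inE star_S // cy eqxx.
have := dc a y yA; rewrite con_ends_tip // -/A => fy.
pose C := con ends (A :\ y) (tip y).
have nCv : C v = false by apply/negbTE; rewrite /C con_sym.
have nCx : C (tip x) = false.
  by apply/negbTE; apply: contra fy => h; apply: con_trans hy _; rewrite con_sym.
pose D := [set g in B | C (ends g).1 != C (ends g).2].
have nD : ~~ con ends (B :\: D) v (tip y).
  apply/negP => h; have : C v = C (tip y).
    apply: con_closed h => g; rewrite !inE negb_and negbK => /andP[/orP[/negP h'|/eqP//] gB].
    by case: h'.
  by rewrite nCv /C con_refl.
have [g [gD gB ng]] := essential_edge (dc b) (sp b v (tip y) vW (inW _ ys)) nD.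
move: gD gB; rewrite !inE => /andP[/andP[gS /eqP cg] gC] _.
have st : step ends S c [eta c with y |-> b, g |-> a].
  apply: swap_step => //; first exact: star_S.
    apply: forest_setU1; last by rewrite con_ends_tip.
    by apply: forest_sub (dc b); apply: subD1set.
  apply: forest_setU1; first by apply: forest_sub (dc a); apply: subD1set.
  apply/negP => h; move: gC; rewrite /C.
  suff -> : con ends (A :\ y) (tip y) (ends g).1 = con ends (A :\ y) (tip y) (ends g).2 by rewrite eqxx.
  by apply/idP/idP => h'; apply: con_trans h' _ => //; rewrite con_sym.
have gr : g \notin star.
  apply: contraNN gC => gs; have : g \in cls star c b by rewrite inE gs cg eqxx.
  rewrite ex inE => /eqP ->; have [[e|e] _ _] := tipP xs; rewrite e /= nCv nCx //.
case: (st) => _ d1 _.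
have nyg : g != y by apply: contraNneq gr => ->.
have eqs j : cls star [eta c with y |-> b, g |-> a] j =
    if j == b then y |: cls star c b else if j == a then cls star c a :\ y else cls star c j.
  apply/setP => e; have [->|njb] := eqVneq j b.
    rewrite in_setU1 ![e \in cls _ _ _]inE /=; have [->|ney] := eqVneq e y; first by rewrite ys eqxx.
    by have [->|//] := eqVneq e g; rewrite (negbTE gr).
  have nbj : (b == j) = false by rewrite eq_sym (negbTE njb).
  have [->|nja] := eqVneq j a.
    rewrite in_setD1 ![e \in cls _ _ _]inE /=; have [->|ney] := eqVneq e y.
      by rewrite [b == a]eq_sym (negbTE nab) andbF.
    by have [->|//] := eqVneq e g; rewrite (negbTE gr).
  have naj : (a == j) = false by rewrite eq_sym (negbTE nja).
  rewrite ![e \in cls _ _ _]inE /=; have [->|ney] := eqVneq e y; first by rewrite nbj cy naj !andbF.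
  by have [->|//] := eqVneq e g; rewrite (negbTE gr).
have yb : y \notin cls star c b by rewrite inE ys cy.
have ya : y \in cls star c a by rewrite inE ys cy eqxx.
have [|c1 [h1 h2 h3]] := IH _ _ d1.
  rewrite ltnS in le; apply: leq_trans le; apply: proper_card; apply/properP; split.
    apply/subsetP => j; rewrite inE [j \in _]inE eqs.
    have [->|njb] := eqVneq j b; first by rewrite cardsU1 yb hb.
    have [->|//] := eqVneq j a => /eqP h.
    by move: ha; rewrite (cardsD1 y (cls star c a)) ya h.
  by exists b; rewrite inE ?hb // eqs eqxx cardsU1 yb hb.
by exists c1; split=> //; apply: conn_step h1.
Qed.

(** * The graph obtained by splitting off pairs at [v] *)

Definition newe (p : U * U) : U := (p.1.1, (tip p.1, tip p.2)).
Definition news (F : seq (U * U)) : {set U} := [set x in map newe F].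
Definition split_off F := rest :|: news F.

Local Notation matching := (matching star).
Local Notation load := (fun X : {set V} => #|inn ends rest X|).
Local Notation valid := (valid tip star k load).
Local Notation sparsef := (sparsef tip k load).
Implicit Types (F G : seq (U * U)) (p q : U * U).

Lemma matching_mem F p : matching F -> p \in F -> p.1 \in star /\ p.2 \in star.
Proof.
move=> /andP[_ /allP h] pF; split; apply: h; rewrite mem_cat; apply/orP; [left|right].
  exact: (map_f fst pF).
exact: (map_f snd pF).
Qed.

Lemma pts_mem F x : x \in pts F -> exists2 p, p \in F & x = p.1 \/ x = p.2.
Proof. by rewrite mem_cat => /orP[] /mapP[p pF ->]; exists p => //; [left|right]. Qed.

Lemma mem_pts F p : p \in F -> p.1 \in pts F /\ p.2 \in pts F.
Proof. by move=> pF; rewrite !mem_cat (map_f fst pF) (map_f snd pF) orbT. Qed.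

Lemma matching_inj F p q x : matching F -> p \in F -> q \in F ->
  x = p.1 \/ x = p.2 -> x = q.1 \/ x = q.2 -> p = q.
Proof.
elim: F => // r F IH; rewrite matching_cons => /and5P[_ _ _ r1 /andP[r2 mF]].
have no z t : t \in F -> z = t.1 \/ z = t.2 -> z = r.1 \/ z = r.2 -> False.
  move=> /mem_pts[h1 h2] ht hr; have zF : z \in pts F by case: ht => ->.
  by case: hr => hz; rewrite hz in zF; rewrite zF in r1 r2.
rewrite !inE => /orP[/eqP->|pF] /orP[/eqP->|qF] // hp hq.
- by case: (no x q).
- by case: (no x p).
- exact: IH.
Qed.

Lemma newe_ends p : p.1 \in star -> p.2 \in star ->
  [/\ (newe p).2.1 != v, (newe p).2.2 != v, (newe p).2.1 \in W :\ v & (newe p).2.2 \in W :\ v].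
Proof. by move=> /tipP[_ h1 h2] /tipP[_ h3 h4]. Qed.

(** The new edge borrows the label of the first edge of its pair. Labels identify the edges of [S],
    and that first edge meets [v] while the new one does not. *)
Lemma newe_notin_S p : p.1 \in star -> p.2 \in star -> newe p \notin S.
Proof.
move=> h1 h2; apply/negP => h; have e : newe p = p.1 by apply: labS => //; apply: star_S.
have [n1 n2 _ _] := newe_ends h1 h2; move: h1; rewrite inE -e (negbTE n1) (negbTE n2).
by rewrite andbF.
Qed.

Lemma newe_inj F : matching F -> {in F &, injective newe}.
Proof.
move=> mF p q pF qF e; have [p1 _] := matching_mem mF pF; have [q1 _] := matching_mem mF qF.
have h : p.1 = q.1 by apply: labS; rewrite ?star_S //; case: e.
by apply: (matching_inj (x := p.1) mF) => //; left.
Qed.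

Lemma matching_uniq F : matching F -> uniq F.
Proof.
by move=> /andP[]; rewrite cat_uniq => /and3P[h _ _] _; apply: map_uniq h.
Qed.

Lemma newsP F x : reflect (exists2 p, p \in F & x = newe p) (x \in news F).
Proof. by rewrite inE; apply: mapP. Qed.

Lemma news_notin_S F x : matching F -> x \in news F -> x \notin S.
Proof.
by move=> mF /newsP[p pF ->]; have [] := matching_mem mF pF; apply: newe_notin_S.
Qed.

Lemma news_rest F x : matching F -> x \in news F -> x \notin rest.
Proof. by move=> mF /(news_notin_S mF); apply: contra; apply: rest_S. Qed.

Lemma card_news F (P : pred U) : matching F ->
  #|[set x in news F | P x]| = count (P \o newe) F.
Proof.
move=> mF; rewrite -size_filter -(size_map newe).
have us : uniq [seq newe q | q <- F & (P \o newe) q].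
  rewrite map_inj_in_uniq ?filter_uniq ?matching_uniq // => p q.
  by rewrite !mem_filter => /andP[_ pF] /andP[_ qF]; apply: (newe_inj mF).
move/card_uniqP: us => <-; apply: eq_card => x; rewrite !inE.
apply/andP/mapP => [[/mapP[p pF ->] h]|[p]].
  by exists p => //; rewrite mem_filter /= h.
by rewrite mem_filter => /andP[h pF] ->; split=> //; apply: map_f.
Qed.

Lemma card_split_off_inn F X : matching F ->
  #|inn ends (split_off F) X| = #|inn ends rest X| + cnt tip F X.
Proof.
move=> mF; have -> : cnt tip F X = #|[set x in news F | (x.2.1 \in X) && (x.2.2 \in X)]|.
  by rewrite (card_news (fun x : U => (x.2.1 \in X) && (x.2.2 \in X)) mF).
have -> : inn ends (split_off F) X =
   inn ends rest X :|: [set x in news F | (x.2.1 \in X) && (x.2.2 \in X)].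
  by apply/setP => x; rewrite in_setU !(inE, in_setU) andb_orl.
rewrite cardsU (_ : _ :&: _ = set0) ?cards0 ?subn0 //.
apply/setP => x; rewrite in_setI in_set0; apply/negP => /andP[/(subsetP (inn_sub _ _ _)) h].
by rewrite inE => /andP[/(news_rest mF)]; rewrite h.
Qed.

Lemma card_split_off F : matching F -> #|split_off F| = #|rest| + size F.
Proof.
move=> mF; rewrite cardsU (_ : _ :&: _ = set0) ?cards0 ?subn0; last first.
  apply/setP => x; rewrite in_setI in_set0; apply/negP => /andP[h].
  by move=> /(news_rest mF); rewrite h.
congr (_ + _); rewrite -(count_predT F) -(card_news predT mF).
by apply: eq_card => x; rewrite !inE andbT.
Qed.

Lemma sparse_split_off F : matching F -> sparsef F <-> sparse ends k (split_off F).
Proof.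
move=> mF; split=> [/sparsefP h X X0|h].
  by rewrite card_split_off_inn //; apply: h.
by apply/sparsefP => X X0; rewrite -card_split_off_inn //; apply: h.
Qed.

(** With this number of pairs, removing [v] lowers the edge count by exactly [k], as [k] trees on
    one vertex less require. *)
Let s := #|star| - k.

Lemma star_ge : k <= #|star|.
Proof.
rewrite (card_cls star c0) -[X in X <= _]muln1 -[X in X * _]card_ord -sum_nat_const.
by apply: leq_sum => i _; apply: star_pos.
Qed.

Lemma s_lt : 2 * s < #|star|.
Proof. by have := star_ge; move: deg_lt; rewrite /s; lia. Qed.

Lemma card_star : #|star| = s + k. Proof. by rewrite subnK ?star_ge. Qed.

Lemma cardW'0 : 0 < #|W :\ v|.
Proof. by rewrite cardW'; move: W2; case: #|W| => [|[]]. Qed.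

Lemma card_rest : #|rest| + s = k * #|W :\ v|.-1.
Proof.
have h : #|rest| + #|star| = #|S|.
  rewrite addnC -(cardsID star S); congr (_ + _); apply: eq_card => e; rewrite in_setI.
  by rewrite andb_idl //; apply: star_S.
move: h; rewrite card_star cardS cardW'; case: #|W| W2 => [|[|n]] //= _.
by rewrite mulnS; lia.
Qed.

Lemma split_off_ends F e : matching F -> e \in split_off F ->
  ((ends e).1 \in W :\ v) && ((ends e).2 \in W :\ v).
Proof.
move=> mF; rewrite in_setU => /orP[/rest_ends[_ _ -> ->] //|/newsP[p pF ->]].
by have [p1 p2] := matching_mem mF pF; have [_ _ -> ->] := newe_ends p1 p2.
Qed.

Lemma split_off_avoids F A : matching F -> A \subset split_off F -> avoids A.
Proof.
by move=> mF /subsetP h e /h /(split_off_ends mF); rewrite !inE => /andP[/andP[-> _] /andP[-> _]].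
Qed.

Lemma split_off_lab F : matching F -> {in split_off F &, injective (fun e : U => e.1)}.
Proof.
move=> mF; have rn x p : x \in rest -> p \in F -> x.1 = (newe p).1 -> x = newe p.
  move=> xr pF e; have [p1 _] := matching_mem mF pF.
  have h : x = p.1 by apply: labS => //; [apply: rest_S|apply: star_S].
  by move: (rest_star xr); rewrite h p1.
move=> x y; rewrite !in_setU => /orP[xr|/newsP[p pF ->]] /orP[yr|/newsP[q qF ->]].
- by apply: labS; apply: rest_S.
- exact: rn.
- by move=> e; apply/esym; apply: rn.
- move=> /= e; have [p1 _] := matching_mem mF pF; have [q1 _] := matching_mem mF qF.
  have h : p.1 = q.1 by apply: labS => //; apply: star_S.
  by rewrite (matching_inj (x := p.1) mF pF qF) //; left.
Qed.

Lemma card_split_offs F : matching F -> size F = s -> #|split_off F| = k * #|W :\ v|.-1.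
Proof. by move=> mF sF; rewrite card_split_off // sF card_rest. Qed.

Lemma span' F c : matching F -> size F = s -> dec ends (split_off F) c ->
  forall i (x y : V), x \in W :\ v -> y \in W :\ v -> con ends (cls (split_off F) c i) x y.
Proof.
move=> mF sF dc; have [] // := card_cls_max cardW'0 _ _ dc; last exact: card_split_offs.
by move=> e; apply: split_off_ends.
Qed.

(** Only colours off [v] are compared: the two edges of a pair need not have the same colour under
    [c]. *)
Definition compat F c := exists2 c', dec ends (split_off F) c' & {in rest, c' =1 c}.

(** The two edges at [v] in a class are paired and replaced by one edge of that class. As each class
    has one or two edges at [v] and there are [s + k] in all, exactly [s] pairs arise. *)
Lemma balanced_compat c : dec ends S c -> (forall i, #|cls star c i| <= 2) ->
  exists F, [/\ valid F, size F = s & compat F c].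
Proof.
move=> dc le2; have pos i := star_pos i dc.
pose two i := #|cls star c i| == 2.
have /fin_all_exists[p hp] : forall i, exists p, [/\ p.1 \in cls star c i, p.2 \in cls star c i,
    two i -> p.1 != p.2 & two i -> cls star c i = [set p.1; p.2]].
  move=> i; rewrite /two; case: (boolP (_ == 2)) => [/cards2P[x [y [nxy ->]]]|_].
    by exists (x, y); split; rewrite /= ?set21 ?set22.
  (* A dummy pair for a class in which [v] is a leaf; [F] leaves it out. *)
  by have /card_gt0P[x xs] := pos i; exists (x, x).
have cp1 i : c (p i).1 = i by case: (hp i); rewrite inE => /andP[_ /eqP].
have cp2 i : c (p i).2 = i by case: (hp i) => _; rewrite inE => /andP[_ /eqP].
have sp1 i : (p i).1 \in star by case: (hp i); rewrite inE => /andP[].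
have sp2 i : (p i).2 \in star by case: (hp i) => _; rewrite inE => /andP[].
pose F := [seq p i | i <- enum two].
have mF : matching F.
  apply/andP; split; last first.
    apply/allP => x; rewrite mem_cat -!map_comp => /orP[] /mapP[i _ ->] /=.
      exact: sp1.
    exact: sp2.
  rewrite cat_uniq -!map_comp !map_inj_in_uniq ?enum_uniq //=; first last.
  - by move=> i j _ _ /= e; rewrite -(cp1 i) e cp1.
  - by move=> i j _ _ /= e; rewrite -(cp2 i) e cp2.
  rewrite andbT; apply/hasPn => x /mapP[i]; rewrite mem_enum => ti ->.
  apply/negP => /mapP[j _ /= e]; have eij : i = j by rewrite -(cp2 i) e cp1.
  by case: (hp i) => _ _ /(_ ti); rewrite e eij eqxx.
have szF : size F = s.
  rewrite size_map -cardE; apply: (@addIn k); rewrite -card_star (card_cls star c).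
  transitivity (\sum_(i < k) ((two i : nat) + 1)).
    rewrite big_split /= sum_nat_const card_ord muln1; congr (_ + _).
    by rewrite -sum1_card big_mkcond; apply: eq_bigr => i _; rewrite -topredE /=; case: (two i).
  apply: eq_bigr => i _; rewrite /two.
  by move: (le2 i) (pos i); case: #|_| => [|[|[]]].
have newT i : two i -> newe (p i) \in news F.
  by move=> ti; apply/newsP; exists (p i) => //; apply/mapP; exists i; rewrite // mem_enum.
have newI i j : newe (p i) = newe (p j) -> i = j.
  move=> e; rewrite -(cp1 i) (_ : (p i).1 = (p j).1) ?cp1 //.
  by apply: labS; rewrite ?star_S //; case: e.
pose T i := cls rest c i :|: (if two i then [set newe (p i)] else set0).
have [||||c' hc'] := @family_colouring U k (split_off F) T.
- by apply: ltn_trans k3.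
- move=> i; rewrite subUset; apply/andP; split.
    by apply: subset_trans (cls_sub _ _ _) (subsetUl _ _).
  case: ifP => [ti|_]; last exact: sub0set.
  by rewrite sub1set in_setU newT ?orbT.
- move=> e; rewrite in_setU => /orP[er|/newsP[q /mapP[i]]].
    by exists (c e); rewrite in_setU inE er eqxx.
  rewrite mem_enum => ti -> ->; exists i; rewrite in_setU.
  have -> : two i by []. 
  by rewrite set11 orbT.
- have T2 i e : e \in T i -> (e \in rest /\ c e = i) \/ (e \notin rest /\ e = newe (p i)).
    rewrite in_setU => /orP[|]; first by rewrite inE => /andP[er /eqP]; left.
    case: ifP => [ti|_]; last by rewrite in_set0.
    by rewrite inE => /eqP->; right; rewrite (news_rest mF) ?newT.
  move=> i j e /T2[[er ci]|[er ei]] /T2[[er' cj]|[er' ej]].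
  - by rewrite -ci -cj.
  - by rewrite er in er'.
  - by rewrite er' in er.
  - by apply: newI; rewrite -ei -ej.
have d' : dec ends (split_off F) c'.
  move=> i; rewrite hc' /T; have fr : forest ends (cls rest c i).
    by apply: forest_sub (dc i); rewrite cls_split subsetUl.
  case: ifP => ti; last by rewrite setU0.
  rewrite setUC; apply: forest_setU1 => //=; apply/negP => h.
  have [h1 h2 /(_ ti) h3 _] := hp i.
  have p1S : (p i).1 \in cls S c i by rewrite cls_split in_setU h1 orbT.
  have := dc i _ p1S; rewrite con_ends_tip //; case/negP.
  have p2S : (p i).2 \in cls S c i :\ (p i).1.
    by rewrite in_setD1 eq_sym h3 cls_split in_setU h2 orbT.
  apply: con_trans (con_tip (sp2 i) p2S) _; rewrite con_sym.
  apply: con_sub h; apply/subsetP => e er; rewrite in_setD1 cls_split in_setU er andbT.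
  have /rest_star : e \in rest by move: er; rewrite inE => /andP[].
  by apply: contraNneq => ->.
exists F; split=> //.
  by rewrite /valid mF; apply/sparse_split_off => //; apply: dec_sparse d'.
exists c' => // e er; have : e \in cls (split_off F) c' (c e).
  by rewrite hc' in_setU inE er eqxx.
by rewrite inE => /andP[_ /eqP].
Qed.

(** * Lifting decompositions of the smaller graph *)

Lemma news_cons p F : news (p :: F) = newe p |: news F.
Proof. by apply/setP => x; rewrite !inE. Qed.

(** The new edges of one tree are traded one by one for edges at [v]. Without [newe q] exactly one
    of its ends is cut off from [v], and the edge of the pair [q] leading to that end takes its
    place. *)
Lemma star_lift F : forall B, matching F -> B \subset S -> forest ends (B :|: news F) ->
  (forall q, q \in F -> con ends (B :|: news F) v (tip q.1) /\ con ends (B :|: news F) v (tip q.2)) ->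
  exists A, [/\ {subset A <= pts F}, [disjoint A & B], #|A| = size F & forest ends (B :|: A)].
Proof.
elim: F => [|q F IH] B mF BS fT cT.
  exists set0; rewrite setU0 cards0 -setI_eq0 set0I; split=> //; first by move=> x; rewrite inE.
  by apply: forest_sub fT; apply: subsetUl.
have [q1 q2] := matching_mem mF (mem_head q F).
have mF' : matching F by move: mF; rewrite matching_cons => /and5P[_ _ _ _ /andP[]].
pose T0 := B :|: news F.
have eT : B :|: news (q :: F) = newe q |: T0 by rewrite news_cons setUCA.
have nqT : newe q \notin T0.
  rewrite in_setU negb_or; apply/andP; split.
    by apply: contra (newe_notin_S q1 q2); apply: (subsetP BS).
  apply/negP => /newsP[r rF e]; have rqF : r \in q :: F by rewrite inE rF orbT.
  have h : r = q by apply: (newe_inj mF); rewrite ?mem_head.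
  move: mF; rewrite matching_cons => /and5P[_ _ _ h1 _].
  by case/negP: h1; rewrite -h; have [] := mem_pts rF.
rewrite eT in fT cT.
have nq : ~~ con ends T0 (tip q.1) (tip q.2).
  by have := fT (newe q) (setU11 _ _); rewrite setU1K.
have fT0 : forest ends T0 by apply: forest_sub fT; apply: subsetUr.
suff main x y : x \in star -> x \in pts (q :: F) -> ~~ con ends T0 v (tip x) ->
    con ends T0 v (tip y) -> (x, y) = q \/ (y, x) = q ->
    exists A, [/\ {subset A <= pts (q :: F)}, [disjoint A & B], #|A| = size (q :: F) &
      forest ends (B :|: A)].
  have [c1 c2] := cT q (mem_head q F); have [m1 m2] := mem_pts (mem_head q F).
  have [h1|h1] := boolP (con ends T0 v (tip q.1)).
    have h2 : ~~ con ends T0 v (tip q.2).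
      by apply: contra nq; apply: con_trans; rewrite con_sym.
    by apply: (main q.2 q.1) => //; right; rewrite -surjective_pairing.
  apply: (main q.1 q.2) => //; last by left; rewrite -surjective_pairing.
  by move/con_setU1: c2 => /= [//|[h _]|[h _]] //; rewrite h in h1.
move=> xs xp nx cy exy.
have fx : forest ends (x |: T0) by apply: forest_setU1 => //; rewrite con_ends_tip.
have ex : (x |: B) :|: news F = x |: T0 by rewrite setUA.
have conq : con ends (x |: T0) (tip q.1) (tip q.2).
  have h1 : con ends (x |: T0) v (tip x) by apply: con_tip => //; apply: setU11.
  have h2 : con ends (x |: T0) v (tip y) by apply: con_sub cy; apply: subsetUr.
  by case: exy => <- /=; [rewrite con_sym in h1; apply: con_trans h1 h2
                         |rewrite con_sym in h2; apply: con_trans h2 h1].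
have mono w : con ends (newe q |: T0) v w -> con ends (x |: T0) v w.
  by move=> h; apply: (con_absorb (e := newe q)) => //; apply: con_sub h; apply: setUS; apply: subsetUr.
have [||||A [sA dA cA fA]] := IH (x |: B).
- by [].
- by rewrite subUset sub1set star_S.
- by rewrite ex.
- move=> r rF; rewrite ex; have rqF : r \in q :: F by rewrite inE rF orbT.
  by have [h1 h2] := cT r rqF; split; apply: mono.
have nxA : x \notin A.
  by apply/negP => xA; move/pred0P: dA => /(_ x); rewrite /= xA setU11.
have nxB : x \notin B.
  by apply: contra nx => xB; apply: con_tip => //; rewrite in_setU xB.
exists (x |: A); split.
- move=> z; rewrite in_setU1 => /orP[/eqP->//|/sA h].
  by rewrite mem_pts_cons h !orbT.
- apply/pred0P => z /=; apply/negP => /andP[]; rewrite in_setU1 => /orP[/eqP->|zA zB].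
    by rewrite (negbTE nxB).
  by move/pred0P: dA => /(_ z); rewrite /= zA in_setU1 zB orbT.
- by rewrite cardsU1 nxA cA.
- by rewrite setUCA setUA.
Qed.

Definition part F c i := [seq p <- F | c (newe p) == i].

Lemma part_mem F c i p : p \in part F c i = (c (newe p) == i) && (p \in F).
Proof. exact: mem_filter. Qed.

Lemma pts_part F c i : {subset pts (part F c i) <= pts F}.
Proof.
move=> x /pts_mem[p]; rewrite part_mem => /andP[_ /mem_pts[h1 h2]] h.
by case: h => ->.
Qed.

Lemma matching_filter F (P : pred (U * U)) : matching F -> matching (filter P F).
Proof.
move=> mF; apply/andP; split; last first.
  apply/allP => x /pts_mem[p]; rewrite mem_filter => /andP[_ pF] hx.
  by have [h1 h2] := matching_mem mF pF; case: hx => ->.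
elim: F mF => //= p F IH; rewrite matching_cons => /and5P[n12 _ _ h1 /andP[h2 mF]].
have sub : {subset pts (filter P F) <= pts F}.
  move=> x /pts_mem[q]; rewrite mem_filter => /andP[_ /mem_pts[? ?]] [] -> //.
case: (P p); last exact: IH.
have e : perm_eq (pts (p :: filter P F)) [:: p.1, p.2 & pts (filter P F)].
  by rewrite /pts /= perm_cons perm_catC /= perm_cons perm_catC.
rewrite (perm_uniq e) /= inE negb_or n12 IH // andbT /=.
by rewrite (contra (sub _) h1) (contra (sub _) h2).
Qed.

Lemma cls_split_off F c i : cls (split_off F) c i = cls rest c i :|: news (part F c i).
Proof.
apply/setP => x; rewrite in_setU ![x \in cls _ _ _]inE in_setU andb_orl; congr (_ || _).
apply/andP/newsP => [[/newsP[p pF ->] h]|[p]]; first by exists p; rewrite // part_mem h.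
by rewrite part_mem => /andP[h pF] ->; split=> //; apply/newsP; exists p.
Qed.

(* The admissible sets of star edges for class [i]: as many as are needed to
   make the class spanning, and not taken from pairs of another class. *)
Definition seat F c i A :=
  [/\ A \subset star, #|A| = (size (part F c i)).+1, forest ends (cls rest c i :|: A) &
      forall e, e \in A -> e \in pts (part F c i) \/ e \notin pts F].

(** [v] is hung on as a leaf by the first edge of one pair [p], and then every new edge of the
    class, that of [p] included, is traded. This gives one edge at [v] more than there are pairs. *)
Lemma class_lift F c i : matching F -> size F = s -> dec ends (split_off F) c ->
  part F c i <> [::] -> exists2 A, seat F c i A & {subset A <= pts (part F c i)}.
Proof.
move=> mF sF dc; set l := part F c i => l0.
have ml : matching l by apply: matching_filter.
case el : l l0 => [//|p l'] _; rewrite -el.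
have pl : p \in l by rewrite el mem_head.
have [p1 p2] := matching_mem ml pl; pose B := p.1 |: cls rest c i.
have eB : B :|: news l = p.1 |: cls (split_off F) c i by rewrite cls_split_off setUA.
have av : avoids (cls (split_off F) c i) by apply: split_off_avoids mF _; apply: cls_sub.
have fB : forest ends (B :|: news l) by rewrite eB; apply: leaf_forest.
have cB q : q \in l -> con ends (B :|: news l) v (tip q.1) /\ con ends (B :|: news l) v (tip q.2).
  move=> ql; have [q1 q2] := matching_mem ml ql; rewrite eB.
  have h0 : con ends (p.1 |: cls (split_off F) c i) v (tip p.1).
    by apply: con_tip => //; apply: setU11.
  have [_ _ tp] := tipP p1; have [_ _ t1] := tipP q1; have [_ _ t2] := tipP q2.
  split; apply: con_trans h0 _; apply: con_sub (subsetUr _ _) _; exact: (span' mF sF dc).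
have BS : B \subset S.
  rewrite subUset sub1set star_S //=; apply: subset_trans (cls_sub _ _ _) _.
  by apply/subsetP => e; apply: rest_S.
have [A [sA dA cA fA]] := star_lift ml BS fB cB.
have np : p.1 \notin A by apply/negP => pA; move/pred0P: dA => /(_ p.1); rewrite /= pA setU11.
have sub : {subset p.1 |: A <= pts l}.
  by move=> z; rewrite in_setU1 => /orP[/eqP->|/sA//]; have [] := mem_pts pl.
exists (p.1 |: A) => //; split.
- apply/subsetP => z /sub /pts_mem[q ql]; have [? ?] := matching_mem ml ql.
  by case=> ->.
- by rewrite cardsU1 np cA.
- by rewrite setUCA setUA.
- by move=> e /sub; left.
Qed.

(** A class without new edges takes an unpaired edge at [v], which exists because
    [2 * s < #|star|]. *)
Lemma seat_exists F c i : matching F -> size F = s -> dec ends (split_off F) c ->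
  exists A, seat F c i A.
Proof.
move=> mF sF dc; have [l0|/eqP l0] := eqVneq (part F c i) [::]; last first.
  by have [A sA _] := class_lift mF sF dc l0; exists A.
have [x xs xF] : exists2 x, x \in star & x \notin pts F.
  have [|x xt xF] := @subsetPn _ (mem star) (mem (pts F)) _; last by exists x.
  apply/negP => /subset_leq_card h; have := card_size (pts F); rewrite size_pts sF => h'.
  by have := leq_trans s_lt (leq_trans h h'); rewrite ltnn.
exists [set x]; split; rewrite ?sub1set ?cards1 ?l0 //.
  rewrite setUC; apply: leaf_forest => //.
    by apply: avoids_rest; apply: cls_sub.
  by apply: forest_sub (dc i); rewrite cls_split_off subsetUl.
by move=> e; rewrite inE => /eqP->; right.
Qed.

(** Prescribing the seat of one class allows two decompositions with a common class to be lifted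
    with that class still common. Other classes with new edges use their own pairs; those without
    wait for a leftover edge, which hangs [v] on as a leaf. *)
Lemma lift_seat F c i0 A0 : matching F -> size F = s -> dec ends (split_off F) c ->
  seat F c i0 A0 ->
  exists g, [/\ dec ends S g, {in rest, g =1 c} & cls S g i0 = cls rest c i0 :|: A0].
Proof.
move=> mF sF dc sA0; pose emp i := part F c i == [::].
have /fin_all_exists[f hf] : forall i, exists A, if i == i0 then A = A0 else
    if emp i then A = set0 else seat F c i A /\ {subset A <= pts (part F c i)}.
  move=> i; case: eqP => _; first by exists A0.
  rewrite /emp; case: eqP => [_|l0]; first by exists set0.
  by have [A ? ?] := class_lift mF sF dc l0; exists A.
have f0 : f i0 = A0 by have := hf i0; rewrite eqxx.
have fstar i : f i \subset star.
  have := hf i; case: eqP => [_ ->|_]; first by case: sA0.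
  by case: (emp i) => [->|[[]]//]; apply: sub0set.
have fcard i : #|f i| + (f i == set0) = (size (part F c i)).+1.
  have seatc A : seat F c i A -> #|A| + (A == set0) = (size (part F c i)).+1.
    by case=> _ cA _ _; rewrite -cards_eq0 cA addn0.
  have := hf i; case: eqP => [-> ->|_]; first by case: sA0 => _ cA _ _; rewrite -cards_eq0 cA addn0.
  case em: (emp i); last by case=> h _; apply: seatc.
  by move=> ->; rewrite eqxx cards0 (eqP em).
have fforest i : forest ends (cls rest c i :|: f i).
  have fr : forest ends (cls rest c i).
    by apply: forest_sub (dc i); rewrite cls_split_off subsetUl.
  have := hf i; case: eqP => [-> ->|_]; first by case: sA0.
  by case: (emp i) => [->|[[]]//]; rewrite setU0.
have fpts i e : e \in f i -> e \in pts (part F c i) \/ (i = i0 /\ e \notin pts F).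
  have := hf i; case: eqP => [-> ->|_].
    by case: sA0 => _ _ _ h /h[]; [left|right].
  by case: (emp i) => [->|[_ h] /h]; [rewrite inE|left].
have pdis i j e : e \in pts (part F c i) -> e \in pts (part F c j) -> i = j.
  move=> /pts_mem[p]; rewrite part_mem => /andP[/eqP cp pF] hp /pts_mem[q].
  rewrite part_mem => /andP[/eqP cq qF] hq.
  by rewrite -cp -cq (matching_inj mF pF qF hp hq).
have fdis i j e : e \in f i -> e \in f j -> i = j.
  move=> /fpts[h1|[-> h1]] /fpts[h2|[-> h2]] //.
  - exact: pdis h1 h2.
  - by rewrite (pts_part h1) in h2.
  - by rewrite (pts_part h2) in h1.
pose R := star :\: \bigcup_i f i; pose J0 := [set i | f i == set0].
(* Each class takes one edge more than it has new edges, except that those in [J0] have taken none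
   yet. Since [#|star| = s + k], exactly one leftover edge remains for each of these. *)
have cR : #|J0| = #|R|.
  have cU : #|\bigcup_i f i| = \sum_i #|f i|.
    have [||||col hcol] := @family_colouring U k (\bigcup_i f i) f.
    - exact: ltn_trans k3.
    - by move=> i; apply: bigcup_sup.
    - by move=> e /bigcupP[i _ ei]; exists i.
    - exact: fdis.
    by rewrite (card_cls _ col); apply: eq_bigr => i _; rewrite hcol.
  have sU : \bigcup_i f i \subset star by apply/bigcupsP.
  have : \sum_i #|f i| + #|J0| = #|star|.
    have -> : #|J0| = \sum_(i < k) (f i == set0).
      by rewrite -sum1_card big_mkcond; apply: eq_bigr => i _; rewrite inE; case: eqP.
    rewrite -big_split /= (eq_bigr _ (fun i _ => fcard i)) card_star -sF.
    under eq_bigr do rewrite -addn1.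
    rewrite big_split /= sum_nat_const card_ord muln1; congr (_ + _).
    rewrite -(count_predT F) -sum1_count (partition_big (fun p => c (newe p)) predT) //=.
    by apply: eq_bigr => i _; rewrite /part size_filter -sum1_count.
  by rewrite -cU -(cardsID (\bigcup_i f i) star) (setIidPr sU) => /addnI.
have [e0 e0s] : exists e, e \in star.
  by apply/card_gt0P; apply: leq_trans star_ge; apply: ltn_trans k3.
have [r [rR rinj rsur]] := finset_bij e0 cR.
have RP i e : e \in R -> e \in f i -> False.
  by rewrite inE => /andP[/bigcupP h _] ei; apply: h; exists i.
pose T i := cls rest c i :|: (f i :|: (if i \in J0 then [set r i] else set0)).
have T2 i e : e \in T i -> [\/ e \in rest /\ c e = i, e \in star /\ e \in f i |
                              [/\ e \in R, i \in J0 & e = r i]].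
  rewrite in_setU => /orP[|]; first by rewrite inE => /andP[er /eqP]; constructor 1.
  rewrite in_setU => /orP[h|]; first by constructor 2; split=> //; apply: (subsetP (fstar i)).
  case: ifP => [iJ|_]; last by rewrite in_set0.
  by rewrite inE => /eqP->; constructor 3; split=> //; apply: rR.
have Rstar e : e \in R -> e \in star by rewrite inE => /andP[].
have [||||g hg] := @family_colouring U k S T.
- by apply: ltn_trans k3.
- move=> i; apply/subsetP => e /T2[[/rest_S//]|[/star_S//]|[/Rstar/star_S//]].
- move=> e eS; have [es|es] := boolP (e \in star); last first.
    by exists (c e); rewrite in_setU inE restP //= eqxx.
  have [/bigcupP[i _ ei]|nU] := boolP (e \in \bigcup_i f i).
    by exists i; rewrite !in_setU ei orbT.
  have [|i iJ <-] := rsur e; first by rewrite inE nU.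
  by exists i; rewrite !in_setU iJ set11 !orbT.
- move=> i j e /T2[[er ci]|[es ei]|[eR iJ ei]] /T2[[er' cj]|[es' ej]|[eR' jJ ej]].
  + by rewrite -ci -cj.
  + by move: (rest_star er); rewrite es'.
  + by move: (rest_star er); rewrite Rstar.
  + by move: (rest_star er'); rewrite es.
  + exact: fdis ei ej.
  + by case: (RP i e).
  + by move: (rest_star er'); rewrite Rstar.
  + by case: (RP j e).
  + by apply: rinj => //; rewrite -ei -ej.
exists g; split.
- move=> i; rewrite hg /T; case: ifP => [iJ|_]; last by rewrite setU0.
  have /eqP -> : f i == set0 by move: iJ; rewrite inE.
  rewrite set0U setUC; apply: leaf_forest; last by apply: Rstar; apply: rR.
    by apply: avoids_rest; apply: cls_sub.
  by apply: forest_sub (dc i); rewrite cls_split_off subsetUl.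
- move=> e er; have : e \in cls S g (c e) by rewrite hg in_setU inE er eqxx.
  by rewrite inE => /andP[_ /eqP].
- rewrite hg /T f0; have -> : i0 \in J0 = false by rewrite inE f0 -cards_eq0; case: sA0 => _ ->.
  by rewrite setU0.
Qed.

Lemma lift_exists F c : matching F -> size F = s -> dec ends (split_off F) c ->
  exists2 g, dec ends S g & {in rest, g =1 c}.
Proof.
move=> mF sF dc; have i0 : 'I_k := Ordinal (ltn_trans (isT : 0 < 2) k3).
have [A sA] := seat_exists i0 mF sF dc.
by have [g [dg hg _]] := lift_seat mF sF dc sA; exists g.
Qed.

(** The shared class has the same edges off [v] and the same new edges on both sides, so one seat
    serves both lifts. *)
Lemma lift_step F c c' : matching F -> size F = s -> step ends (split_off F) c c' ->
  exists g g', [/\ {in rest, g =1 c}, {in rest, g' =1 c'} & step ends S g g'].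
Proof.
move=> mF sF [dc dc' [i ei]]; have [A sA] := seat_exists i mF sF dc.
have er : cls rest c i = cls rest c' i.
  apply/setP => e; have := congr1 (fun Z : {set U} => e \in Z) ei.
  by rewrite /= ![e \in cls _ _ _]inE in_setU; case: (e \in rest).
have ep : part F c i = part F c' i.
  apply: eq_in_filter => p pF; have := congr1 (fun Z : {set U} => newe p \in Z) ei.
  have h : newe p \in news F by apply/newsP; exists p.
  by rewrite /= ![newe p \in cls _ _ _]inE in_setU h orbT.
have sA' : seat F c' i A by case: sA => h1 h2 h3 h4; split; rewrite // -?ep -?er.
have [g [dg hg cg]] := lift_seat mF sF dc sA.
have [g' [dg' hg' cg']] := lift_seat mF sF dc' sA'.
by exists g, g'; split=> //; split=> //; exists i; rewrite cg cg' er.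
Qed.

(** * Links between different pairings *)

Hypothesis IHs : forall F c c', matching F -> size F = s ->
  dec ends (split_off F) c -> dec ends (split_off F) c' -> conn ends (split_off F) c c'.

(** Lifts of consecutive steps need not fit together at [v], but they agree off [v], which is enough
    to connect them. *)
Lemma lift_conn F c c' : matching F -> size F = s -> conn ends (split_off F) c c' ->
  dec ends (split_off F) c' ->
  forall g g', dec ends S g -> dec ends S g' -> {in rest, g =1 c} -> {in rest, g' =1 c'} ->
  conn ends S g g'.
Proof.
move=> mF sF; elim=> [{}c|{c c'} c c1 c2 st _ IH] dc' g g' dg dg' hg hg'.
  by apply: same_rest_conn => // e er; rewrite hg // hg'.
have [h [h' [hc hc1 sth]]] := lift_step mF sF st; case: (sth) => dh dh' _.
apply: (@conn_trans _ _ _ _ _ _ h).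
  by apply: same_rest_conn => // e er; rewrite hg // hc.
by apply: conn_step sth _; apply: IH.
Qed.

Definition linked F G := forall c c', dec ends S c -> dec ends S c' ->
  compat F c -> compat G c' -> conn ends S c c'.

Lemma linked_refl F : matching F -> size F = s -> linked F F.
Proof.
move=> mF sF c c' dc dc' [b db hb] [b' db' hb'].
apply: (lift_conn mF sF (IHs mF sF db db')) => // e er.
  by rewrite hb.
by rewrite hb'.
Qed.

Lemma valid_dec F : valid F -> exists b : U -> 'I_k, dec ends (split_off F) b.
Proof.
case/andP=> mF /(sparse_split_off mF) h; apply: sparse_dec => //.
exact: ltn_trans k3.
Qed.

Lemma valid_compat F : valid F -> size F = s -> exists2 g, dec ends S g & compat F g.
Proof.
move=> vF sF; have [b db] := valid_dec vF; have /andP[mF _] := vF.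
by have [g dg hg] := lift_exists mF sF db; exists g => //; exists b => // e er; rewrite hg.
Qed.

Lemma linked_trans F G Q : valid G -> size G = s -> linked F G -> linked G Q -> linked F Q.
Proof.
move=> vG sG h1 h2 c c' dc dc' cF cQ; have [g dg cg] := valid_compat vG sG.
by apply: conn_trans (h1 c g dc dg cF cg) (h2 g c' dg dc' cg cQ).
Qed.

Lemma linked_sym F G : linked F G -> linked G F.
Proof. by move=> h c c' dc dc' cF cG; apply: conn_sym; apply: h. Qed.

Lemma linked_perm F G : valid F -> size F = s -> perm_eq F G -> linked F G.
Proof.
move=> vF sF pe; have e : split_off F = split_off G.
  congr (_ :|: _); apply/setP => x; rewrite !inE; exact: (perm_mem (perm_map newe pe)).
have h : linked F F by apply: linked_refl => //; case/andP: vF.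
by move=> c c' dc dc' cF cG; apply: h => //; case: cG => b; rewrite -e => db hb; exists b.
Qed.

(** The new edge of [q] replaces that of [p] in its class and no colour off [v] changes. A lift of
    the old decomposition is then compatible with both pairings and links them. *)
Lemma linked_transfer p q G (b : U -> 'I_k) : valid (p :: G) -> (size G).+1 = s -> matching (q :: G) ->
  dec ends (split_off (p :: G)) b ->
  ~~ con ends (cls (split_off (p :: G)) b (b (newe p)) :\ newe p) (tip q.1) (tip q.2) ->
  valid (q :: G) /\ linked (p :: G) (q :: G).
Proof.
move=> vp sG mq db nq; have /andP[mp _] := vp; set i := b (newe p) in nq.
have [p1 p2] := matching_mem mp (mem_head p G); have [q1 q2] := matching_mem mq (mem_head q G).
have pnG (t : U * U) : matching (t :: G) -> newe t \notin split_off G.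
  move=> mt; have [t1 t2] := matching_mem mt (mem_head t G).
  rewrite in_setU negb_or; apply/andP; split.
    by apply: contra (newe_notin_S t1 t2); apply: rest_S.
  apply/negP => /newsP[r rG e]; have rt : r \in t :: G by rewrite inE rG orbT.
  have h : r = t by apply: (newe_inj mt); rewrite ?mem_head.
  move: mt; rewrite matching_cons => /and5P[_ _ _ h1 _].
  by case/negP: h1; rewrite -h; have [] := mem_pts rG.
have so t : split_off (t :: G) = newe t |: split_off G by rewrite /split_off news_cons setUCA.
pose b' := [eta b with newe q |-> i].
have clsq j : cls (split_off (q :: G)) b' j =
    if j == i then newe q |: (cls (split_off (p :: G)) b i :\ newe p)
    else cls (split_off (p :: G)) b j.
  have npG := pnG p mp; have nqG := pnG q mq.
  apply/setP => e; have [->|nji] := eqVneq j i.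
    rewrite in_setU1 in_setD1 ![e \in cls _ _ _]inE !so !in_setU1 /=.
    have [->|neq] := eqVneq e (newe q); first by rewrite eqxx.
    by have [->|nep] := eqVneq e (newe p); first by rewrite (negbTE npG).
  have nij : (i == j) = false by rewrite eq_sym (negbTE nji).
  rewrite ![e \in cls _ _ _]inE !so !in_setU1 /=.
  have [->|neq] := eqVneq e (newe q).
    rewrite nij (negbTE nqG) orbF andbF.
    (* The two new edges can coincide, namely when the pairs have the same first edge and their
       second edges have the same far end. *)
    by have [->|//] := eqVneq (newe q) (newe p); rewrite -/i nij.
  by have [->|nep] := eqVneq e (newe p); first by rewrite (negbTE npG) -/i nij.
have db' : dec ends (split_off (q :: G)) b'.
  move=> j; rewrite clsq; case: eqP => // _; apply: forest_setU1 => //.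
  by apply: forest_sub (db i); apply: subD1set.
have vq : valid (q :: G).
  by rewrite /valid mq; apply/sparse_split_off => //; apply: dec_sparse db'.
split=> // c c' dc dc' cp cq.
have [g dg hg] := lift_exists mp sG db.
have cg : compat (p :: G) g by exists b => // e er; rewrite hg.
have cg' : compat (q :: G) g.
  exists b' => // e er; rewrite hg //=; case: eqP => // ee.
  by move: (newe_notin_S q1 q2); rewrite -ee rest_S.
apply: conn_trans (linked_refl mp sG dc dg cp cg) _.
exact: (linked_refl mq sG dg dc' cg' cq).
Qed.

(** Without the edge of [(a, b)] its class separates [tip a] from [tip b], so [tip x] is separated
    from at least one of them. *)
Lemma linked_alt a b x G : valid ((a, b) :: G) -> (size G).+1 = s ->
  matching ((a, x) :: G) -> matching ((b, x) :: G) ->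
  (valid ((a, x) :: G) /\ linked ((a, b) :: G) ((a, x) :: G)) \/
  (valid ((b, x) :: G) /\ linked ((a, b) :: G) ((b, x) :: G)).
Proof.
move=> vab sG max mbx; have [d dd] := valid_dec vab.
pose A := cls (split_off ((a, b) :: G)) d (d (newe (a, b))) :\ newe (a, b).
have nab : ~~ con ends A (tip a) (tip b).
  apply: (dd (d (newe (a, b))) (newe (a, b))); rewrite inE eqxx andbT in_setU.
  by rewrite news_cons setU11 orbT.
have [h|h] := boolP (con ends A (tip a) (tip x)); last first.
  by left; apply: (linked_transfer vab sG max dd h).
right; apply: (linked_transfer vab sG mbx dd); apply: contra nab => h'.
by apply: con_trans h _; rewrite con_sym.
Qed.

(** Reversing a pair changes the label and the direction of the new edge, so formally this is
    another graph. *)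
Lemma linked_flip a b G : valid ((a, b) :: G) -> (size G).+1 = s ->
  valid ((b, a) :: G) /\ linked ((a, b) :: G) ((b, a) :: G).
Proof.
move=> vab sG; have /andP[mab _] := vab; have [d dd] := valid_dec vab.
apply: (linked_transfer vab sG _ dd).
  move: mab; rewrite !matching_cons /= => /and5P[h1 -> -> -> /andP[-> ->]].
  by rewrite eq_sym h1.
rewrite /= con_sym; apply: (dd (d (newe (a, b))) (newe (a, b))); rewrite inE eqxx andbT in_setU.
by rewrite news_cons setU11 orbT.
Qed.

(** [linked_alt] is used from both sides: either it gives the link at once, or both pairings are
    linked to one that pairs [b] with [x]. *)
Lemma linked_shared a b x G : valid ((a, b) :: G) -> valid ((a, x) :: G) -> (size G).+1 = s ->
  linked ((a, b) :: G) ((a, x) :: G).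
Proof.
move=> vb vx sG; have [<-|nbx] := eqVneq b x; first by apply: linked_refl => //; case/andP: vb.
have /andP[mb _] := vb; have /andP[mx _] := vx.
have mbx : matching ((b, x) :: G) && matching ((x, b) :: G).
  move: mb mx; rewrite !matching_cons /= => /and5P[_ _ -> _ /andP[-> ->]] /and5P[_ _ -> _ /andP[-> _]].
  by rewrite nbx eq_sym nbx.
case/andP: mbx => mbx mxb.
case: (linked_alt vb sG mx mbx) => [[_ //]|[vbx l1]].
case: (linked_alt vx sG mb mxb) => [[_ /linked_sym //]|[vxb l2]].
have [_ l3] := linked_flip vbx sG.
apply: (linked_trans vbx sG l1); apply: (linked_trans vxb sG l3).
exact: linked_sym.
Qed.

(** Unless [x] already occurs in [(a, b)], a pair made of [x] and one of [a], [b] is put in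
    between. *)
Lemma linked_exch p q G : (size G).+1 = s -> valid (p :: G) -> valid (q :: G) ->
  linked (p :: G) (q :: G).
Proof.
case: p => a b; case: q => x y sG vp vq.
have [vp' lp] := linked_flip vp sG; have [vq' lq] := linked_flip vq sG.
have [eax|nax] := eqVneq a x; first by subst x; apply: linked_shared.
have [ebx|nbx] := eqVneq b x.
  by subst x; apply: (linked_trans vp' sG lp); apply: linked_shared.
have /andP[mp _] := vp; have /andP[mq _] := vq.
have m2 : matching ((a, x) :: G) && matching ((b, x) :: G).
  move: mp mq; rewrite !matching_cons /=.
  move=> /and5P[_ -> -> -> /andP[-> ->]] /and5P[_ -> _ -> _].
  by rewrite nax nbx.
case/andP: m2 => max mbx.
have [[v1 l1]|[v1 l1]] := linked_alt vp sG max mbx; apply: (linked_trans v1 sG l1);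
  have [v2 l2] := linked_flip v1 sG; apply: (linked_trans v2 sG l2); exact: linked_shared.
Qed.

Lemma star_conn c c' : dec ends S c -> dec ends S c' -> conn ends S c c'.
Proof.
move=> dc dc'; have [c1 [h1 d1 le1]] := balance dc; have [c2 [h2 d2 le2]] := balance dc'.
have [F1 [v1 s1 cp1]] := balanced_compat d1 le1.
have [F2 [v2 s2 cp2]] := balanced_compat d2 le2.
apply: conn_trans h1 _; apply: conn_trans (conn_sym h2).
suff h : linked F1 F2 by apply: h.
apply: (@matchings_linked _ _ tip star k load (fun X Y => inn_super ends rest X Y) s linked s_lt
  linked_perm linked_exch linked_trans [::] F1 F2) => //.
by rewrite s1.
Qed.
End Star.

(** * Induction on the number of vertices *)

Lemma star_sum (V L : finType) (W : {set V}) (S : {set L * (V * V)}) :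
  \sum_(v in W) #|star S v| <= 2 * #|S|.
Proof.
under eq_bigr => v _ do rewrite -sum1_card.
rewrite (exchange_big_dep (mem S)) /=; last by move=> v e _; rewrite inE => /andP[].
rewrite mulnC -sum_nat_const; apply: leq_sum => e eS.
rewrite sum1_card; apply: leq_trans (_ : #|[set e.2.1; e.2.2]| <= 2); last first.
  by rewrite cards2; case: (_ != _).
apply: subset_leq_card; apply/subsetP => v; rewrite -topredE /= => /andP[_].
by rewrite inE => /andP[_ h]; rewrite !inE !(eq_sym v).
Qed.

Lemma trees_conn (V L : finType) (k : nat) (W : {set V}) (S : {set L * (V * V)}) :
  2 < k -> 0 < #|W| ->
  (forall e, e \in S -> (e.2.1 \in W) && (e.2.2 \in W)) ->
  {in S &, injective (fun e : L * (V * V) => e.1)} ->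
  #|S| = k * #|W|.-1 ->
  forall c c' : L * (V * V) -> 'I_k, dec snd S c -> dec snd S c' -> conn snd S c c'.
Proof.
move=> k3; have [n] := ubnP #|W|; elim: n W S => // n IH W S le W0 SW lab cS c c' dc dc'.
have [W1|W2] := leqP #|W| 1.
  have S0 : S = set0.
    by apply/eqP; rewrite -cards_eq0 cS; move: W0 W1; case: #|W| => [|[]] //; rewrite muln0.
  apply: conn1; split=> //; exists (Ordinal (ltn_trans (isT : 0 < 2) k3)).
  by apply/setP => e; rewrite !inE S0 inE.
have [v vW dv] : exists2 v, v \in W & #|star S v| < 2 * k.
  have [/exists_inP[v vW h]|/exists_inPn h] := boolP [exists v in W, #|star S v| < 2 * k].
    by exists v.
  have : \sum_(v in W) 2 * k <= 2 * #|S|.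
    by apply: leq_trans (star_sum W S); apply: leq_sum => v /h; rewrite -leqNgt.
  rewrite sum_nat_const cS; case: #|W| W0 => // m _ /=.
  rewrite [2 * (k * m)]mulnA [_ * m]mulnC leq_pmul2r ?ltnn //.
  by rewrite muln_gt0 (ltn_trans _ k3).
apply: (star_conn k3 vW W2 SW lab cS dc dv _ dc dc') => F b b' mF sF db db'.
have cW := cardW' vW.
apply: (IH (W :\ v)) db db'.
- by rewrite cW; move: le W0; case: #|W|.
- exact: cardW'0.
- by move=> e; apply: (split_off_ends SW dc mF).
- exact: (split_off_lab lab mF).
- exact: (card_split_offs k3 vW W2 SW lab cS dc dv mF sF).
Qed.

(** * Bases of the cycle matroid *)

Section CycleMatroid.
Variables (V E : finType) (ends : E -> V * V).
Implicit Types (A B C S : {set E}).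

Lemma degFU1 S e w : e \notin S ->
  degF ends (e |: S) w = degF ends S w + (((ends e).1 == w) + ((ends e).2 == w)).
Proof.
have h (P : pred E) : e \notin S -> #|[set f in e |: S | P f]| = #|[set f in S | P f]| + P e.
  move=> eS; rewrite (cardsD1 e [set f in e |: S | P f]) !inE eqxx /= addnC; congr (_ + _).
  apply: eq_card => f; rewrite !inE; case: (eqVneq f e) => [->|] //=.
  by rewrite (negbTE eS).
by move=> eS; rewrite /degF !h //; lia.
Qed.

Lemma degF0 w : degF ends set0 w = 0.
Proof. by rewrite /degF !(eq_card0 (A := [set _ in set0 | _])) // => e; rewrite !inE. Qed.

(** The degree formula encodes degree two at inner vertices and one at the two ends; for a path of a
    single vertex both corrections fall on it and leave degree zero. *)
Lemma path_edges A x p : path (adjF ends A) x p -> uniq (x :: p) ->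
  exists S, [/\ S \subset A,
    forall w, degF ends S w + (w == x) + (w == last x p) = 2 * (w \in x :: p) &
    forall f, f \in S -> con ends S x (ends f).1].
Proof.
elim: p x => [|z p IH] x.
  move=> _ _; exists set0; split; first exact: sub0set.
    by move=> w; rewrite degF0 inE /= add0n addnn mul2n.
  by move=> f; rewrite inE.
rewrite [path _ _ _]/= => /andP[/adjFP[e eA hxz] pp].
rewrite cons_uniq => /andP[xp uz]; have [S [SA dS cS]] := IH z pp uz.
have eS : e \notin S.
  have := dS x; rewrite (negbTE xp) muln0 => /eqP; rewrite -addnA addn_eq0 => /andP[/eqP d0 _].
  apply/negP => eS; move: d0 => /eqP; rewrite addn_eq0 !cards_eq0 => /andP[/eqP/setP h1 /eqP/setP h2].
  have := h1 e; have := h2 e; rewrite !inE eS /=.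
  by case: hxz => -> /=; rewrite eqxx.
have sub : S \subset e |: S by apply: subsetUr.
have cxz : con ends (e |: S) x z.
  by have := con_edge ends (setU11 e S); case: hxz => -> //=; rewrite con_sym.
exists (e |: S); split.
- by rewrite subUset sub1set eA.
- move=> w; rewrite degFU1 //; have := dS w; rewrite [last x _]/= [w \in x :: _]inE.
  have -> : ((ends e).1 == w) + ((ends e).2 == w) = (w == x) + (w == z).
    by case: hxz => -> /=; rewrite !(eq_sym w) // addnC.
  have [->|nwx] /= := eqVneq w x; first by rewrite (negbTE xp) /=; clear; lia.
  by rewrite add0n addn0.
- move=> f; rewrite in_setU1 => /orP[/eqP->|fS]; last first.
    by apply: con_trans cxz (con_sub sub (cS f fS)).
  by case: hxz => -> //=; apply: con_refl.
Qed.

(** An edge that is not a bridge closes a simple path between its ends to a cycle; for a loop that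
    path is empty. *)
Lemma acyclic_forest A : acyclic ends A -> forest ends A.
Proof.
move=> acA e eA; apply/negP => /connectP[p0 pp0]; case/shortenP: pp0 => p pp up _ {p0} lp.
have [S [SA dS cS]] := path_edges pp up.
have eS : e \notin S by apply/negP => /(subsetP SA); rewrite in_setD1 eqxx.
apply: (acA (e |: S)).
  by rewrite subUset sub1set eA (subset_trans SA (subD1set _ _)).
have cx f : f \in e |: S -> connect (adjF ends (e |: S)) (ends e).1 (ends f).1.
  rewrite in_setU1 => /orP[/eqP->|/cS]; first exact: con_refl.
  by apply: con_sub; apply: subsetUr.
split.
- by apply/set0Pn; exists e; rewrite setU11.
- move=> w; rewrite degFU1 // addnA; have := dS w; rewrite -lp !(eq_sym w) => ->.
  by case: (w \in _).
- move=> f g fS gS; apply: con_trans (cx g gS).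
  by rewrite con_sym; apply: cx.
Qed.

Lemma degF_sum C (A : {set V}) : \sum_(w in A) degF ends C w =
  #|[set f in C | (ends f).1 \in A]| + #|[set f in C | (ends f).2 \in A]|.
Proof.
have h (g : E -> V) : \sum_(w in A) #|[set f in C | g f == w]| = #|[set f in C | g f \in A]|.
  rewrite -[RHS]sum1_card (partition_big g (mem A)) /=; last by move=> f; rewrite inE => /andP[].
  apply: eq_bigr => w wA; rewrite -sum1_card; apply: eq_bigl => f; rewrite !inE.
  by case: (eqVneq (g f) w) => [->|]; rewrite ?wA ?andbT ?andbF.
by rewrite big_split /= (h (fun f => (ends f).1)) (h (fun f => (ends f).2)).
Qed.

(* A cycle would meet the edge cut of a bridge in exactly one edge, although
   all its degrees are even. *)
Lemma forest_acyclic B : forest ends B -> acyclic ends B.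
Proof.
move=> fB C CB [/set0Pn[e eC] deg _].
have fC := forest_sub CB fB; have ne := fC e eC.
pose A := [set w | con ends (C :\ e) (ends e).1 w].
have := degF_sum C A; have : ~~ odd (\sum_(w in A) degF ends C w).
  elim/big_rec: _ => // w m _ hm; rewrite oddD (negbTE hm) addbF.
  by case/orP: (deg w) => /eqP->.
have cl f : f \in C :\ e -> ((ends f).1 \in A) = ((ends f).2 \in A).
  by move=> fC'; rewrite !inE; apply: con_set_closed.
rewrite (cardsD1 e) (cardsD1 e [set f in C | (ends f).2 \in A]).
rewrite !in_set eC con_refl (negbTE ne) /=.
have -> : [set f in C | (ends f).1 \in A] :\ e = [set f in C | (ends f).2 \in A] :\ e.
  apply/setP => f; rewrite !in_setD1 !in_set; case: eqVneq => //= nfe.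
  by case: (boolP (f \in C)) => //= fC'; have := cl f; rewrite in_setD1 nfe fC' !in_set => ->.
by move=> h1 h2; move: h1; rewrite h2 add0n -addnA addnn oddD odd_double.
Qed.

(** An edge with separated ends could be added to [B]; conversely, if all edges have connected ends,
    an added edge is not a bridge. *)
Lemma is_baseP B : is_base ends B <-> forest ends B /\ forall e, con ends B (ends e).1 (ends e).2.
Proof.
split=> [[acB mx]|[fB cB]].
  have fB := acyclic_forest acB; split=> // e; apply/negPn/negP => ne.
  have h : e |: B = B.
    by apply: mx; [apply: subsetUr|apply: forest_acyclic; apply: forest_setU1].
  by case/negP: ne; apply: con_edge; rewrite -h setU11.
split; first exact: forest_acyclic.
move=> B' BB' acB'; have fB' := acyclic_forest acB'.
apply/eqP; rewrite eqEsubset BB' andbT; apply/subsetP => e eB'.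
apply: contraNT (fB' e eB') => eB; apply: con_sub (cB e).
by apply/subsetP => f fB1; rewrite in_setD1 (subsetP BB') // andbT; apply: contraNneq eB => <-.
Qed.

(** * Gluing the roots of the components *)

Local Notation R := (con ends setT).
Local Notation rt := (root (adjF ends setT)).
Variable r0 : V.
Hypothesis r0_root : rt r0 = r0.

Lemma R_sym : connect_sym (adjF ends setT).
Proof. by move=> x y; apply: con_sym. Qed.

Lemma rtP x y : R x y = (rt x == rt y). Proof. by rewrite (root_connect R_sym). Qed.

Lemma rt_rt x : rt (rt x) = rt x.
Proof. by apply/eqP; rewrite -rtP con_sym; apply: connect_root. Qed.

(* All component roots are identified with [r0]. *)
Definition glue (x : V) := if rt x == x then r0 else x.

Lemma glue_eq x y : glue x = glue y -> x = y \/ rt x = x /\ rt y = y.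
Proof.
rewrite /glue; case: (eqVneq (rt x) x) => hx; case: (eqVneq (rt y) y) => hy h.
- by right.
- by move: hy; rewrite -h r0_root eqxx.
- by move: hx; rewrite h r0_root eqxx.
- by left.
Qed.

Definition emb (e : E) : E * (V * V) := (e, (glue (ends e).1, glue (ends e).2)).

Lemma emb_inj : injective emb. Proof. by move=> e f []. Qed.

Lemma con_glue A x y : con ends A x y -> con snd (emb @: A) (glue x) (glue y).
Proof.
move=> h; rewrite -(con_closed (C := fun z => con snd (emb @: A) (glue x) (glue z)) _ h) ?con_refl //.
by move=> e eA; apply: (con_set_closed snd (glue x) (imset_f emb eA)).
Qed.

(** A walk in the glued graph changes component only at the glued vertex. [ok z] records what a walk
    from [x] to [z] yields: a connection in [A] if both lie in one component, otherwise connections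
    of [x] and of [z] to their own roots. [Q] demands this of all vertices glued to the same
    point. *)
Lemma glue_con A x y : R x y -> con snd (emb @: A) (glue x) (glue y) -> con ends A x y.
Proof.
move=> xy h.
pose ok z := if R x z then con ends A x z else con ends A x (rt x) && con ends A z (rt z).
pose Q q := [forall z, (glue z == q) ==> ok z].
suff : Q (glue y) by move=> /forallP/(_ y); rewrite eqxx /ok xy.
rewrite -(con_closed (C := Q) _ h).
  apply/forallP => z; apply/implyP => /eqP /glue_eq[->|[hz hx]]; rewrite /ok.
    by rewrite rtP eqxx con_refl.
  by rewrite rtP hz hx; case: eqVneq => [->|_]; rewrite !con_refl.
have main a b : con ends A a b -> R a b -> Q (glue a) -> Q (glue b).
  move=> cab rab /forallP/(_ a); rewrite eqxx /= => oka.
  have eab : rt a = rt b by apply/eqP; rewrite -rtP.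
  apply/forallP => z; apply/implyP => /eqP /glue_eq[->|[hz hb]].
    move: oka; rewrite /ok !rtP eab; case: eqP => _; first by move=> h'; apply: con_trans h' cab.
    by case/andP=> -> h'; apply: con_trans h'; rewrite con_sym.
  move: oka; rewrite /ok !rtP eab hz hb con_refl andbT.
  case: (eqVneq (rt x) b) => [xb h'|nxb /andP[h' _]].
    have h2 : con ends A x (rt x) by rewrite xb; apply: con_trans h' cab.
    by case: eqVneq => // <-.
  by case: eqVneq => // <-.
move=> _ /imsetP[e eA ->] /=.
have cA := con_edge ends eA; have cR := con_sub (subsetT A) cA.
apply/idP/idP; apply: main => //; first by rewrite con_sym.
by rewrite con_sym.
Qed.

Lemma edge_R e : R (ends e).1 (ends e).2. Proof. by apply: con_edge; rewrite inE. Qed.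

Lemma emb_setD1 A e : emb @: (A :\ e) = (emb @: A) :\ emb e.
Proof.
apply/setP => f; apply/imsetP/idP => [[g]|].
  rewrite in_setD1 => /andP[nge gA] ->; rewrite in_setD1 imset_f // andbT.
  by apply: contraNneq nge => /emb_inj->.
rewrite in_setD1 => /andP[nfe /imsetP[g gA eg]]; exists g => //.
by rewrite in_setD1 gA andbT; apply: contraNneq nfe => <-; rewrite eg.
Qed.

Lemma forest_emb A : forest ends A <-> forest snd (emb @: A).
Proof.
split=> [fA _ /imsetP[e eA ->]|fA e eA].
  rewrite -emb_setD1; apply: contra (fA e eA); apply: glue_con; exact: edge_R.
have := fA _ (imset_f emb eA); rewrite -emb_setD1; apply: contra; exact: con_glue.
Qed.

Definition glued : {set V} := [set x | (rt x != x) || (x == r0)].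

Lemma glue_in x : glue x \in glued.
Proof. by rewrite inE /glue; case: ifP => [_|->]; rewrite ?eqxx ?orbT. Qed.

(** Each component has one root, and of all the roots only [r0] survives. *)
Lemma card_glued : #|glued| = (cycle_rank ends).+1.
Proof.
pose Z := [set x | rt x == x].
have cZ : #|Z| = ncomp ends.
  rewrite /ncomp /n_comp_mem; apply: eq_card => x; rewrite !inE /=.
  by rewrite /roots /= andbT.
have -> : glued = r0 |: ~: Z by apply/setP => x; rewrite !inE orbC.
rewrite cardsU1 !inE r0_root eqxx /= /cycle_rank -cZ.
by have := cardsC Z; rewrite cardT -cardE => <-; rewrite addKn.
Qed.

Definition embT : {set E * (V * V)} := emb @: setT.

Lemma embT_ends e : e \in embT -> (e.2.1 \in glued) && (e.2.2 \in glued).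
Proof. by case/imsetP => f _ -> /=; rewrite !glue_in. Qed.

(** The image of a base is a spanning tree of the glued graph: every vertex is connected in [B] to
    its root. *)
Lemma card_base B : is_base ends B -> #|B| = cycle_rank ends.
Proof.
move=> /is_baseP[fB cB]; have := fB => /forest_emb fB'.
have iB : inn snd (emb @: B) glued = emb @: B.
  apply/setP => f; rewrite inE; apply: andb_idr => /imsetP[e _ ->] /=.
  by rewrite !glue_in.
have cc x : con ends B x (rt x).
  have : R x (rt x) by apply: connect_root.
  move=> h; rewrite -(con_closed (C := con ends B x) _ h) ?con_refl // => e _.
  apply/idP/idP => h'; apply: con_trans h' _ => //; by rewrite con_sym.
have up x : x \in glued -> con snd (emb @: B) x r0.
  rewrite inE => /orP[nx|/eqP->]; last exact: con_refl.
  by have := con_glue (cc x); rewrite /glue rt_rt eqxx (negbTE nx).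
have h1 := @con_card_forest _ _ snd (emb @: B) glued fB'.
have h2 := @forest_card _ _ snd (emb @: B) glued fB'.
rewrite iB card_imset in h1 h2; [|exact: emb_inj..].
have : #|glued| <= #|B|.+1.
  by apply: h1 => x y xg yg; apply: con_trans (up x xg) _; rewrite con_sym up.
have : #|B| < #|glued| by apply: h2; rewrite -card_gt0 card_glued.
by rewrite card_glued !ltnS => g1 g2; apply/eqP; rewrite eqn_leq g1.
Qed.

(** * Families of disjoint bases as colourings *)

Section Colourings.
Variable k : nat.
Hypothesis k3 : 2 < k.
Hypothesis cardE' : #|E| = k * cycle_rank ends.
Hypothesis E0 : 0 < #|E|.
Implicit Types (c : E * (V * V) -> 'I_k) (P Q : {set {set E}}).

Lemma k_gt0 : 0 < k. Proof. exact: ltn_trans k3. Qed.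

Definition classes c : {set {set E}} := [set [set e | c (emb e) == i] | i : 'I_k].

Lemma card_embT : #|embT| = k * #|glued|.-1.
Proof. by rewrite card_imset ?cardsT ?cardE' ?card_glued //; apply: emb_inj. Qed.

Lemma cls_embT c i : cls embT c i = emb @: [set e | c (emb e) == i].
Proof.
apply/setP => f; rewrite inE; apply/andP/imsetP => [[/imsetP[e _ ->] h]|[e]].
  by exists e; rewrite // inE.
by rewrite inE => h ->; split=> //; apply: imset_f.
Qed.

Lemma class_base c i : dec snd embT c -> is_base ends [set e | c (emb e) == i].
Proof.
move=> dc; apply/is_baseP; split; first by apply/forest_emb; rewrite -cls_embT; apply: dc.
move=> e; apply: glue_con; first exact: edge_R.
have g0 : 0 < #|glued| by rewrite card_glued.
have [_ h] := card_cls_max g0 embT_ends card_embT dc.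
by rewrite -cls_embT; apply: h; rewrite glue_in.
Qed.

Lemma rank_gt0 : 0 < cycle_rank ends.
Proof. by move: E0; rewrite cardE' muln_gt0 => /andP[]. Qed.

Lemma classes_vertex c : dec snd embT c -> kbase_vertex ends k (classes c).
Proof.
move=> dc; split.
(* Positive rank makes the classes nonempty, hence distinct, so there are really [k] of them. *)
- rewrite card_imset ?card_ord // => i j /setP eij.
  have /card_gt0P[e ei] : 0 < #|[set e | c (emb e) == i]|.
    by rewrite card_base ?rank_gt0 //; apply: class_base.
  by have := eij e; rewrite ei inE => /esym/eqP <-; move: ei; rewrite inE => /eqP ->.
- by move=> _ /imsetP[i _ ->]; apply: class_base.
- apply/trivIsetP => _ _ /imsetP[i _ ->] /imsetP[j _ ->] nij.
  apply/pred0P => e /=; rewrite !inE; apply/negP => /andP[/eqP hi /eqP hj].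
  by move: nij; rewrite -hi -hj eqxx.
Qed.

Lemma conn_path c c' : conn snd embT c c' -> kbase_path ends k (classes c) (classes c').
Proof.
elim=> [{}c|{c c'} c c1 c2 [dc dc1 [i ei]] _ IH]; first exact: kbp_refl.
apply: kbp_step IH; split; [exact: classes_vertex..|].
exists [set e | c (emb e) == i]; split; apply/imsetP; exists i => //.
by apply: (imset_inj emb_inj); rewrite -!cls_embT.
Qed.

Lemma vertex_classes P : kbase_vertex ends k P -> exists2 c, dec snd embT c & classes c = P.
Proof.
case=> cP bP tP; pose b (i : 'I_k) := nth set0 (enum P) i.
have szP : size (enum P) = k by rewrite -cardE.
have bM i : b i \in P by rewrite -mem_enum mem_nth ?szP.
have bI : injective b.
  by move=> i j /eqP; rewrite nth_uniq ?szP ?enum_uniq // => /eqP/val_inj.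
have bS B : B \in P -> exists i, b i = B.
  rewrite -mem_enum => BP; have lt : index B (enum P) < k by rewrite -szP index_mem.
  by exists (Ordinal lt); rewrite /b nth_index.
(* Disjoint bases, [k] in number and each as large as the rank, exhaust the edges by counting. *)
have covP : cover P = setT.
  apply/eqP; rewrite eqEcard subsetT cardsT cardE' -(eqP tP) -cP -sum_nat_const.
  by apply: leq_sum => B BP; rewrite card_base //; apply: bP.
have [||||c hc] := @family_colouring _ k embT (fun i => emb @: b i).
- exact: k_gt0.
- by move=> i; apply: imsetS; apply: subsetT.
- move=> _ /imsetP[e _ ->]; have : e \in cover P by rewrite covP inE.
  by case/bigcupP=> B /bS[i <-] ei; exists i; apply: imset_f.
- move=> i j _ /imsetP[e ei ->] /imsetP[f fj /emb_inj efj]; rewrite -efj in fj.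
  apply/eqP; apply: contraT => nij; have nb : b i != b j by apply: contra nij => /eqP/bI->.
  by move/trivIsetP: tP => /(_ _ _ (bM i) (bM j) nb) /pred0P/(_ e); rewrite /= ei fj.
have hb i : [set e | c (emb e) == i] = b i.
  by apply: (imset_inj emb_inj); rewrite -cls_embT hc.
exists c.
  by move=> i; rewrite hc; apply/forest_emb; case/is_baseP: (bP _ (bM i)).
apply/setP => B; apply/imsetP/idP => [[i _ ->]|/bS[i <-]]; first by rewrite hb.
by exists i.
Qed.

Lemma glued_connected : kbase_graph_connected ends k.
Proof.
move=> P Q /vertex_classes[c dc <-] /vertex_classes[c' dc' <-].
apply: conn_path; apply: (trees_conn (W := glued)) => //.
- by rewrite card_glued.
- exact: embT_ends.
- by move=> _ _ /imsetP[e _ ->] /imsetP[f _ ->] /= ->.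
- exact: card_embT.
Qed.

End Colourings.
End CycleMatroid.

Theorem theorem3p1 (V E : finType) (ends : E -> V * V) (k : nat) :
  3 <= k ->
  #|E| = k * cycle_rank ends ->
  kbase_graph_connected ends k.
Proof.
move=> k3 cE P Q vP vQ.
(* [P] has at least two different members, so there is an edge; the component root of its first end
   serves as [r0]. *)
have /card_gt0P[e _] : 0 < #|E|.
  rewrite lt0n; apply/negP => /eqP E0; case: vP => cP _ _.
  have : 1 < #|P| by rewrite cP ltnW.
  case/card_gt1P => A [B [_ _]]; case/eqP; apply/setP => e.
  by have := fintype0 e; rewrite E0 => /(_ erefl).
apply: (@glued_connected V E ends (root (adjF ends setT) (ends e).1)) => //.
  exact: rt_rt.
by apply/card_gt0P; exists e.
Qed.
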